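(* Suppose that the destinations ${\bf x}^{(n)} = \{ {\bf x}_1, \dots, {\bf x}_n\}$ are contained in a compact region $R \subseteq \mathbb{R}^2$ (not depending on $n$) and are such that the limit $r^* = \lim_{n \to \infty} \overline{r}(n)$ exists. Then, for any $z \in \mathbb{R}$ and $\lambda = \lambda(z)$ we have, almost surely, $$\limsup_{n \to \infty} \frac{1}{n} \left( \mathrm{Cost}_{P}(z; {\bf x}^{(n)}) - \mathrm{Cost}_V({\bf x}^{(n)}) \right) \leq - \alpha(T,\lambda) \left( \left(\zeta_V+\frac{h_V}{v_V}\right) \frac{2r^*}{V} - \left(\zeta_P+\frac{h_P}{v_P}\right) \frac{r^*}{E[B]} - (h_P\tau_P - h_V\tau_V) - z \left( \frac{r^*}{v_P E[B]} + \tau_P \right) \right).$$ Moreover, whenever $$\left(\zeta_V+\frac{h_V}{v_V}\right) \frac{2r^*}{V} - \left(\zeta_P+\frac{h_P}{v_P}\right) \frac{r^*}{E[B]} - (h_P\tau_P - h_V\tau_V) > 0,$$ there exists a $z \in \mathbb{R}$ for which the upper bound $$- \alpha(T,\lambda(z)) \left( \left(\zeta_V+\frac{h_V}{v_V}\right) \frac{2r^*}{V} - \left(\zeta_P+\frac{h_P}{v_P}\right) \frac{r^*}{E[B]} - (h_P\tau_P - h_V\tau_V) - z \left( \frac{r^*}{v_P E[B]} + \tau_P \right) \right)$$ for the limit superior $\limsup_{n \to \infty} \frac{1}{n} \left( \mathrm{Cost}_{P}(z; {\bf x}^{(n)}) - \mathrm{Cost}_V({\bf x}^{(n)}) \right)$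 is strictly negative.
   Context: Pick-up model. Fix $m\in\mathbb{N}_+$ and a probability distribution $F$ supported on $\{1,\dots,m\}$; $B$ denotes a random variable with distribution $F$. There are $n$ packages at locations $1,\dots,n$ arranged on a circle (locations taken modulo $n$), all available at time $0$. To each location $i$ is attached a Poisson process of rate $\lambda>0$; the processes at different locations are independent, and each point carries a mark; all marks are i.i.d. with distribution $F$ and independent of all the Poisson processes. A point at location $i$ with mark $k$ is a request for the packages $i,i+1,\dots,i+k-1$ (modulo $n$); it is accepted if $k\le n$ and all these packages are still available at that time, in which case they are all picked up (removed permanently), and otherwise it is rejected and nothing changes. $\tilde N(t,n,\lambda)$ is the number of packages picked up during $[0,t]$, $\mathcal{C}(t,n,\lambda)=E[\tilde N(t,n,\lambda)]$, and $\alpha(t,\lambda):=\lim_{n\to\infty}\mathcal{C}(t,n,\lambda)/n$ (this limit exists). $T>0$ is a fixed time horizon. Destinations. For each $n$, the $n$ packages have destinations ${\bf x}^{(n)}=\{{\bf x}_1,\dots,{\bf x}_n\}\subseteq\mathbb{R}^2$ (possibly random, and then independent of the request processes), indexed in the order of an optimal traveling salesman tour, the package at location $i$ of the circle having destination ${\bf x}_i$. The depot is at the origin $\boldsymbol{0}$; $d$ is one of the $L_p$ distances on $\mathbb{R}^2$; $r_i=d({\bf x}_i,\boldsymbol{0})$ and $\overline r(n)=\frac1n\sum_{i=1}^n r_i$. $L(\mathrm{TSP}({\bf y}))$ is the length of an optimal traveling salesman tour through the point set ${\bf y}$. $L(\mathrm{CVRP}({\bf y}))$ is the length of an optimal solution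 of the capacitated vehicle routing problem, i.e. the minimal total length of a family of closed routes, each starting and ending at the depot and serving at most $V$ points, which together serve every point of ${\bf y}$; $V\in\mathbb{N}_+$ is the fixed van capacity. ${\bf Y}^{(n)}(\lambda)$ is the (random) set of the destinations of the $n-\tilde N(T,n,\lambda)$ packages not picked up by time $T$ when the request rate is $\lambda$. $\mathbb{E}_n[\,\cdot\,]=E[\,\cdot\,|\,{\bf x}^{(n)}]$. Parameters. $\zeta_P,h_P,\tau_P,v_P$ (per-mile cost, opportunity cost per unit of time, end-point delivery time, and speed of private drivers) and $\zeta_V,h_V,\tau_V,v_V$ (per-mile cost, wage rate, end-point delivery time, and speed of vans) are fixed positive constants. The real variable $z$ is the incentive rate and $\lambda(\cdot)$ is a monotone non-decreasing, almost everywhere differentiable function of $z\in\mathbb{R}$ with $\lambda(z)>0$. Costs. $$\mathrm{Cost}_{P}(z; {\bf x}^{(n)}) := \frac{\mathcal{C}(T,n,\lambda(z))}{n}\left(\zeta_P+\frac{h_P+z}{v_P}\right)\left(\frac{n \overline{r}(n) }{E[B]} +L(\mathrm{TSP}({\bf x}^{(n)}))\right) +\mathcal{C}(T,n,\lambda(z))(h_P+z) \tau_P + (n - \mathcal{C}(T,n,\lambda(z)))\, h_V \tau_V + \left(\zeta_V+\frac{h_V}{v_V}\right) \mathbb{E}_n\left[ L(\mathrm{CVRP}({\bf Y}^{(n)}(\lambda(z)) )) \right],$$ $$\mathrm{Cost}_{V}({\bf x}^{(n)}) := \left( \zeta_V + \frac{h_V}{v_V} \right) L(\mathrm{CVRP}({\bf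 x}^{(n)}) ) + n h_V \tau_V.$$ *)

(* Defs.v *)
From HB Require Import structures.
From mathcomp Require Import all_boot all_order all_algebra.
From mathcomp Require Import finmap.
From mathcomp Require Import all_classical all_reals all_analysis.

Set Implicit Arguments.
Unset Strict Implicit.
Unset Printing Implicit Defensive.

Import Order.TTheory GRing.Theory Num.Theory.
Import numFieldNormedType.Exports.

Local Open Scope classical_set_scope.
Local Open Scope ring_scope.

Section tours.
Variable R : realType.

Definition Lp_dist (p : \bar R) (a b : R * R) : R :=
  match p with
  | r%:E => (`|a.1 - b.1| `^ r + `|a.2 - b.2| `^ r) `^ r^-1
  | +oo%E => Num.max `|a.1 - b.1| `|a.2 - b.2|
  | -oo%E => 0
  end.

Variable d : R * R -> R * R -> R.

Fixpoint path_length (a : R * R) (s : seq (R * R)) : R :=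
  if s is b :: s' then d a b + path_length b s' else 0.

Definition closed_length (s : seq (R * R)) : R :=
  if s is a :: s' then path_length a (rcons s' a) else 0.

Variables (I : finType) (y : I -> R * R).

(* Points are indexed by I, so that packages with equal destinations are
   counted separately. *)
Definition tsp_length : R :=
  inf [set closed_length (map y s) | s in [set s | perm_eq s (enum I)]].

(* A route is the list of the points it serves, in the order of the visits;
   the depot is at the origin. *)
Definition cvrp_length (V : nat) (A : {set I}) : R :=
  inf [set \sum_(r <- rs) closed_length (0 :: map y r) | rs in
    [set rs : seq (seq I) |
      all (fun r => (size r <= V)%N) rs /\ flatten rs =i A]].

End tours.

Section pickup_dynamics.
Variables (R : realType) (n : nat).

(* The packages i, i+1, ..., i+k-1 modulo n, with locations numbered from 0. *)
Definition requested (i : 'I_n) (k : nat) : {set 'I_n} :=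
  [set j : 'I_n | [exists l : 'I_k, ((i + l) %% n)%N == j]].

Definition serve (A : {set 'I_n}) (q : 'I_n * nat) : {set 'I_n} :=
  if (q.2 <= n)%N && (requested q.1 q.2 \subset A)
  then A :\: requested q.1 q.2 else A.

(* S i j and M i j are the time and the mark of the j-th point at location i.
   The set of the points up to time t is almost surely finite and the times are
   almost surely distinct; on the exceptional null event the value is
   irrelevant (fset_set of an infinite set is empty). *)
Definition available (S : 'I_n -> nat -> R) (M : 'I_n -> nat -> nat) (t : R)
    : {set 'I_n} :=
  let pts := fset_set [set q : 'I_n * nat | S q.1 q.2 <= t] in
  let chron := sort (fun q q' => S q.1 q.2 <= S q'.1 q'.2) (enum_fset pts) in
  foldl serve [set: 'I_n]%SET [seq (q.1, M q.1 q.2) | q <- chron].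

End pickup_dynamics.

Section requests.
Context {R : realType} {d : measure_display} {T : measurableType d}.
Variable P : probability T R.

Definition mutually_independent (I : eqType) (G : I -> set_system T) : Prop :=
  forall (J : seq I) (E : I -> set T), uniq J ->
    (forall i, i \in J -> G i (E i)) ->
    P (\bigcap_(i in [set` J]) E i) = (\prod_(i <- J) P (E i))%E.

Definition independent_systems (G H : set_system T) : Prop :=
  forall A B, G A -> H B -> P (A `&` B) = (P A * P B)%E.

(* Points are numbered from 0: gap i 0 is the time of the first point at location
   i, gap i j.+1 is the time between its points j and j.+1, and mark i j is the
   mark of point j. A Poisson process of rate lam is one whose gaps are i.i.d.
   exponential of rate lam. *)
Record requests (n : nat) := Requests {
  gap : 'I_n -> nat -> {RV P >-> R};
  mark : 'I_n -> nat -> {RV P >-> nat}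
}.

Definition arrival n (q : requests n) (w : T) (i : 'I_n) (j : nat) : R :=
  \sum_(l < j.+1) gap q i l w.

Definition request_events n (q : requests n)
    (k : ('I_n * nat) + ('I_n * nat)) : set_system T :=
  match k with
  | inl ij => preimage_set_system setT (gap q ij.1 ij.2) measurable
  | inr ij => preimage_set_system setT (mark q ij.1 ij.2) measurable
  end.

Definition request_sigma n (q : requests n) : set_system T :=
  <<s \bigcup_k request_events q k >>.

Definition marked_poisson (F : probability nat R) (lam : R) n
    (q : requests n) : Prop :=
  [/\ forall i j B, measurable B ->
        distribution P (gap q i j) B = exponential_prob lam B,
      forall i j B, measurable B -> distribution P (mark q i j) B = F B &
      mutually_independent (request_events q)].

Definition remaining n (q : requests n) (t : R) (w : T) : {set 'I_n} :=
  available (arrival q w) (fun i j => mark q i j w) t.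

Definition pickups n (q : requests n) (t : R) (w : T) : nat :=
  #|~: remaining q t w|.

Definition mean_pickups n (q : requests n) (t : R) : R :=
  fine 'E_P[fun w => (pickups q t w)%:R].

Definition pickup_density (q : forall n, R -> requests n) (t lam : R) : R :=
  limn (fun n => mean_pickups (q n lam) t / n%:R).

(* Y is a version of E[X | G], where G is a sub-sigma-algebra and X is
   integrable. *)
Definition is_cond_expectation (G : set_system T) (X Y : T -> R) : Prop :=
  [/\ forall B : set R, measurable B -> G (Y @^-1` B),
      P.-integrable setT (EFin \o Y) &
      forall A, G A -> (\int[P]_(w in A) (Y w)%:E = \int[P]_(w in A) (X w)%:E)%E].

End requests.

Section costs.
Variable R : realType.

Record driver := Driver {
  mile_cost : R;   (* zeta *)
  hourly_cost : R; (* h *)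
  stop_time : R;   (* tau *)
  speed : R        (* v *)
}.

Definition driver_positive (a : driver) : Prop :=
  [/\ 0 < mile_cost a, 0 < hourly_cost a, 0 < stop_time a & 0 < speed a].

Variables (p v : driver) (EB : R) (V : nat).

Definition cost_P (n : nat) (z C rbar tsp ecvrp : R) : R :=
  C / n%:R * (mile_cost p + (hourly_cost p + z) / speed p)
    * (n%:R * rbar / EB + tsp)
  + C * (hourly_cost p + z) * stop_time p
  + (n%:R - C) * hourly_cost v * stop_time v
  + (mile_cost v + hourly_cost v / speed v) * ecvrp.

Definition cost_V (n : nat) (cvrp : R) : R :=
  (mile_cost v + hourly_cost v / speed v) * cvrp
  + n%:R * hourly_cost v * stop_time v.

Definition margin (r : R) : R :=
  (mile_cost v + hourly_cost v / speed v) * (2 * r / V%:R)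
  - (mile_cost p + hourly_cost p / speed p) * (r / EB)
  - (hourly_cost p * stop_time p - hourly_cost v * stop_time v).

Definition upper_bound (alpha z r : R) : R :=
  - alpha * (margin r - z * (r / (speed p * EB) + stop_time p)).

End costs.

(* Main.v *)
Require Import Defs.
From HB Require Import structures.
From mathcomp Require Import all_boot all_order all_algebra.
From mathcomp Require Import finmap.
From mathcomp Require Import all_classical all_reals all_analysis.
From mathcomp Require Import measurable_realfun.
From mathcomp Require Import ring lra zify.

Set Implicit Arguments.
Unset Strict Implicit.
Unset Printing Implicit Defensive.

Import Order.TTheory GRing.Theory Num.Theory.
Import numFieldNormedType.Exports.

Local Open Scope classical_set_scope.
Local Open Scope ring_scope.

(** The cost difference is controlled by two facts about the set of packages
that are left at time [T].

Geometry. A route that serves [k <= V] points is at least as long as twice their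
mean distance to the depot, whence [cvrp >= 2 / V * sum of the distances]
([cvrp_length_ge]). Conversely, let the points be visited cell after cell of a
fine grid: in a bounded region this walk has length [o(n)], and cutting it into
batches of [V] consecutive points gives routes whose total length is
[2 / V * sum of the distances + o(n)], uniformly in the positions
([cvrp_length_le_box]); the tour through all the points has length [o(n)] as
well ([tsp_length_le_box]).

Probability. Let [alpha] be the limit of the mean proportion of packages picked
up. As [n] tends to infinity, every single package is picked up with a
probability close to [alpha], uniformly in the package ([picked_near]). By
independence, the conditional expectation of the sum of the distances over the
remaining packages is [1 - alpha] times the full sum, up to [o(n)]
([cond_expectation_le]). Hence the vans save at least
[alpha * 2 / V * sum of the distances - o(n)] of their driving, while the
private drivers cost a fraction [alpha] of an explicit quantity;
[limn_esup_cost] combines the two.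

The limit [alpha] exists, and is the same for all packages, because the dynamics
are local. An arc of [m] consecutive locations without any request before [T]
cannot be crossed by a request of at most [m] packages, so that the packages
between two such arcs evolve as they would on any other circle with the same
requests there ([available_local]). Such arcs are found on both sides of a given
package within distance [B * m], except with a probability that is geometric in
[B] ([probability_no_block]), and the law of the requests seen through a window
does not depend on the circle ([window_law]); this makes the probabilities Cauchy
([picked_close]).

For the last assertion, [z = 0] will do: the bound is then [- alpha] times the
margin, and [alpha > 0] because each location that has received a request misses
one of its next [m] packages ([density_gt0]). *)

(** * The L_p metrics of the plane *)

Section lp_metric.
Variable R : realType.
Implicit Types (p : \bar R) (a b c : R * R) (r s t x y : R).

(** [(x + y) / (s + t)] is the convex combination of [x / s] and [y / t] with the
weights [s / (s + t)] and [t / (s + t)]. *)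
Lemma powR_add_le r s t x y : 1 <= r -> 0 < s -> 0 < t -> 0 <= x -> 0 <= y ->
  (x + y) `^ r <=
    (s + t) `^ r * (s / (s + t) * (x / s) `^ r + t / (s + t) * (y / t) `^ r).
Proof.
move=> r1 s0 t0 x0 y0; have st0 : 0 < s + t by rewrite addr_gt0.
have w0 : 0 <= s / (s + t) by rewrite divr_ge0// ltW.
have w1 : s / (s + t) <= 1 by rewrite ler_pdivrMr// mul1r lerDl ltW.
have wE : 1 - s / (s + t) = t / (s + t) by field; rewrite gt_eqF.
have xs0 : 0 <= x / s by rewrite divr_ge0// ltW.
have yt0 : 0 <= y / t by rewrite divr_ge0// ltW.
have := convex_powR r1 (Itv01 w0 w1); move=> /(_ (x / s) (y / t)).
rewrite !inE /= !in_itv /= !andbT => /(_ xs0 yt0).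
rewrite [leRHS]convRE /= /unstable.onem wE => h.
have -> : x + y = (s + t) * (s / (s + t) * (x / s) + t / (s + t) * (y / t)).
  by field; rewrite !gt_eqF.
rewrite powRM ?(ltW st0)//; last first.
  by rewrite addr_ge0// mulr_ge0// divr_ge0// ltW.
by rewrite ler_wpM2l ?powR_ge0//; move: h; rewrite {1}[conv _ _ _]convRE /= /unstable.onem wE.
Qed.

Lemma powR_norm_le r s x y : 1 <= r -> 0 < s -> 0 <= x -> 0 <= y ->
  x `^ r + y `^ r <= s `^ r -> (x / s) `^ r + (y / s) `^ r <= 1.
Proof.
move=> r1 s0 x0 y0 h; have si0 : 0 <= s^-1 by rewrite invr_ge0 ltW.
have sV : s^-1 `^ r = (s `^ r)^-1.
  by rewrite -[s^-1]powR_inv1 ?ltW// -powRrM mulN1r powRN.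
by rewrite !powRM// -mulrDl sV ler_pdivrMr ?mul1r// powR_gt0.
Qed.

(** With [s] and [t] the norms of the two pairs, the convexity bounds of the two
coordinates add up to [(s + t) `^ r]. *)
Lemma minkowski_pair r (x1 x2 y1 y2 : R) : 1 <= r ->
  0 <= x1 -> 0 <= x2 -> 0 <= y1 -> 0 <= y2 ->
  ((x1 + y1) `^ r + (x2 + y2) `^ r) `^ r^-1 <=
    (x1 `^ r + x2 `^ r) `^ r^-1 + (y1 `^ r + y2 `^ r) `^ r^-1.
Proof.
move=> r1 x10 x20 y10 y20.
have r0 : 0 < r by exact: lt_le_trans r1.
have rK' z : 0 <= z -> (z `^ r) `^ r^-1 = z.
  by move=> z0; rewrite -powRrM mulfV ?gt_eqF// powRr1.
have root_le A s : 0 <= A -> A `^ r^-1 <= s -> A <= s `^ r.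
  move=> A0 As; have s0 : 0 <= s by exact: le_trans (powR_ge0 _ _) As.
  have -> : A = (A `^ r^-1) `^ r by rewrite -powRrM mulVf ?gt_eqF// powRr1.
  by rewrite ge0_ler_powR ?(ltW r0) ?nnegrE ?powR_ge0.
(* A norm may vanish: one divides by a slightly larger positive number. *)
have below A e : 0 < e -> exists2 s, 0 < s & A `^ r^-1 <= s /\ s = A `^ r^-1 + e.
  move=> e0; exists (A `^ r^-1 + e); first by rewrite ltr_wpDl ?powR_ge0.
  by rewrite lerDl ltW.
apply/ler_addgt0Pr => e e0.
have e20 : 0 < e / 2 by rewrite divr_gt0.
have [s s0 [hs sE]] := below (x1 `^ r + x2 `^ r) _ e20.
have [t t0 [ht tE]] := below (y1 `^ r + y2 `^ r) _ e20.
apply: (@le_trans _ _ (s + t)); last by rewrite sE tE addrACA -splitr.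
have st0 : 0 < s + t by rewrite addr_gt0.
have hx : (x1 / s) `^ r + (x2 / s) `^ r <= 1.
  by apply: powR_norm_le => //; apply: root_le; rewrite ?addr_ge0 ?powR_ge0.
have hy : (y1 / t) `^ r + (y2 / t) `^ r <= 1.
  by apply: powR_norm_le => //; apply: root_le; rewrite ?addr_ge0 ?powR_ge0.
rewrite -[leRHS]rK' ?(ltW st0)//.
rewrite ge0_ler_powR ?invr_ge0 ?(ltW r0) ?nnegrE ?addr_ge0 ?powR_ge0//.
apply: le_trans (lerD (powR_add_le r1 s0 t0 x10 y10)
  (powR_add_le r1 s0 t0 x20 y20)) _.
rewrite -mulrDr -[leRHS]mulr1 ler_wpM2l ?powR_ge0//.
have -> : 1 = s / (s + t) * 1 + t / (s + t) * 1 by field; rewrite gt_eqF.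
rewrite addrACA -!mulrDr lerD// ler_wpM2l// divr_ge0// ltW//.
Qed.

(** What the routing estimates use of the metric. *)
Definition planar_metric (d : R * R -> R * R -> R) :=
  [/\ forall a b, 0 <= d a b, forall a b, d a b = d b a,
      forall a b c, d a c <= d a b + d b c &
      forall a b, d a b <= `|a.1 - b.1| + `|a.2 - b.2|].

Lemma Lr_dist_planar r : 1 <= r -> planar_metric (Lp_dist r%:E).
Proof.
move=> r1; have r0 : 0 < r by exact: lt_le_trans r1.
have rK z : 0 <= z -> (z `^ r) `^ r^-1 = z.
  by move=> z0; rewrite -powRrM mulfV ?gt_eqF// powRr1.
have tri a b c : Lp_dist r%:E a c <= Lp_dist r%:E a b + Lp_dist r%:E b c.
  have := minkowski_pair r1 (normr_ge0 (a.1 - b.1)) (normr_ge0 (a.2 - b.2))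
    (normr_ge0 (b.1 - c.1)) (normr_ge0 (b.2 - c.2)).
  apply: le_trans; have ri0 : 0 <= r^-1 by rewrite invr_ge0 ltW.
  have mono x y : 0 <= x -> x <= y -> x `^ r <= y `^ r.
    move=> x0 xy; apply: (ge0_ler_powR (ltW r0)) => //; rewrite nnegrE//.
    exact: le_trans xy.
  apply: (ge0_ler_powR ri0); rewrite ?nnegrE ?addr_ge0 ?powR_ge0//.
  by apply: lerD; apply: mono => //; exact: ler_distD.
split => [a b|a b|//|a b] /=.
- exact: powR_ge0.
- by rewrite (distrC b.1) (distrC b.2).
(* Go from [a] to [b] along the axes. *)
- apply: le_trans (tri a (b.1, a.2) b) _ => /=.
  rewrite !subrr normr0 powR0 ?gt_eqF// addr0 add0r !rK//.
Qed.

Lemma Lp_dist_planar p : (1 <= p)%E -> planar_metric (Lp_dist p).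
Proof.
case: p => [r r1|_|]; last by rewrite leeNy_eq.
  rewrite lee_fin in r1; exact: Lr_dist_planar.
split => [a b|a b|a b c|a b] /=.
- by rewrite le_max normr_ge0.
- by rewrite !(distrC b.1) (distrC b.2).
- rewrite ge_max; apply/andP; split.
    by apply: le_trans (ler_distD b.1 _ _) _; rewrite lerD// le_max lexx.
  by apply: le_trans (ler_distD b.2 _ _) _; rewrite lerD// le_max lexx orbT.
- by rewrite ge_max lerDl lerDr !normr_ge0.
Qed.

Lemma measurable_Lp_dist0 p : (1 <= p)%E ->
  measurable_fun [set: R * R] (fun a => Lp_dist p a 0).
Proof.
have m1 : measurable_fun [set: R * R] (fun a => `|a.1 - 0|).
  under eq_fun do rewrite subr0; exact: measurableT_comp.
have m2 : measurable_fun [set: R * R] (fun a => `|a.2 - 0|).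
  under eq_fun do rewrite subr0; exact: measurableT_comp.
case: p => [r _|_|]; last by rewrite leeNy_eq.
  have m3 : measurable_fun [set: R * R] (fun a => `|a.1 - 0| `^ r + `|a.2 - 0| `^ r).
    apply: measurable_funD.
      exact: (measurableT_comp (measurable_powR r) m1).
    exact: (measurableT_comp (measurable_powR r) m2).
  exact: (measurableT_comp (measurable_powR r^-1) m3).
exact: measurable_maxr m1 m2.
Qed.

End lp_metric.

(** * Lengths of routes *)

Section routing.
Variables (R : realType) (d : R * R -> R * R -> R).
Hypothesis hd : planar_metric d.
Implicit Types (a b : R * R) (s t : seq (R * R)).

Let d_ge0 a b : 0 <= d a b. Proof. by case: hd. Qed.
Let dC a b : d a b = d b a. Proof. by case: hd. Qed.
Let d_tri a b c : d a c <= d a b + d b c. Proof. by case: hd. Qed.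

Lemma path_length_ge0 a s : 0 <= path_length d a s.
Proof. by elim: s a => //= b s IHs a; rewrite addr_ge0. Qed.

Lemma path_length_cat a s t :
  path_length d a (s ++ t) = path_length d a s + path_length d (last a s) t.
Proof. by elim: s a => [|b s IHs] a /=; rewrite ?add0r// IHs addrA. Qed.

Lemma dist_last_path a s : d a (last a s) <= path_length d a s.
Proof.
elim: s a => [|b s IHs] a /=.
  by case: hd => _ _ _ /(_ a a); rewrite !subrr !normr0 addr0.
by apply: le_trans (d_tri a b _) _; rewrite lerD2l.
Qed.

Lemma dist_path a b s : b \in a :: s ->
  d a b <= path_length d a s /\ d b (last a s) <= path_length d a s.
Proof.
elim: s a b => [|c s IHs] a b /=.
  by rewrite inE => /eqP ->; split; exact: (dist_last_path a [::]).
rewrite inE => /predU1P[->|/IHs[h1 h2]]; split.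
- by apply: le_trans (dist_last_path a [::]) _; exact: path_length_ge0 a (c :: s).
- exact: dist_last_path a (c :: s).
- by apply: le_trans (d_tri a c b) _; rewrite lerD2l.
- by apply: le_trans h2 _; rewrite lerDr.
Qed.

Lemma closed_length_ge0 s : 0 <= closed_length d s.
Proof. by case: s => // a s; exact: path_length_ge0. Qed.

(** A closed route from the depot goes to [b] and back. *)
Lemma route_ge b s : b \in s -> 2 * d b 0 <= closed_length d (0 :: s).
Proof.
move=> /splitPr[s1 s2] /=; rewrite rcons_cat path_length_cat /=.
rewrite mulr_natl mulr2n addrA lerD//.
  rewrite dC; apply: le_trans (d_tri 0 (last 0 s1) b) _.
  by rewrite lerD2r dist_last_path.
by have := dist_last_path b (rcons s2 0); rewrite last_rcons.
Qed.

Lemma route_ge_mean V s : (size s <= V)%N ->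
  2 * (\sum_(b <- s) d b 0) <= V%:R * closed_length d (0 :: s).
Proof.
move=> sV; apply: (@le_trans _ _ (\sum_(b <- s) closed_length d (0 :: s))).
  by rewrite mulr_sumr big_seq [leRHS]big_seq ler_sum// => b; exact: route_ge.
rewrite big_const_seq count_predT iter_addr addr0 -[_ *+ _]mulr_natl.
by rewrite ler_wpM2r ?closed_length_ge0// ler_nat.
Qed.

Definition walk_length s := if s is a :: s' then path_length d a s' else 0.

Lemma walk_length_cat s t :
  walk_length s + walk_length t <= walk_length (s ++ t).
Proof.
case: s => [|a s]/=; first by rewrite add0r.
rewrite path_length_cat lerD2l; case: t => //= b t.
by rewrite lerDr.
Qed.

(** A full van shares its detour to and from the depot among all the points that
it serves; each of them is as far from the depot as the first one, up to the
length of the walk. *)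
Lemma full_route_le V s : (0 < V)%N -> size s = V ->
  closed_length d (0 :: s) <=
    2 / V%:R * (\sum_(b <- s) d b 0) + 3 * walk_length s.
Proof.
move=> V0 sV; have VR : 0 < V%:R :> R by rewrite ltr0n.
case: s sV => [|a s] sV; first by rewrite -sV in V0.
have far b : b \in a :: s ->
    d 0 a + d (last a s) 0 <= 2 * d b 0 + 2 * walk_length (a :: s).
  move=> /dist_path[h1 h2] /=.
  have h3 := d_tri 0 b a; rewrite (dC b a) (dC 0 b) in h3.
  have h4 := d_tri (last a s) b 0; rewrite (dC _ b) in h4.
  lra.
have -> : closed_length d [:: 0, a & s] =
    d 0 a + d (last a s) 0 + walk_length (a :: s).
  by rewrite /= -cats1 path_length_cat /= addr0 addrA addrAC.
have h : V%:R * (d 0 a + d (last a s) 0) <=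
    2 * (\sum_(b <- a :: s) d b 0) + V%:R * (2 * walk_length (a :: s)).
  have e z : V%:R * z = \sum_(b <- a :: s) z.
    by rewrite big_const_seq count_predT iter_addr addr0 sV mulr_natl.
  rewrite !e mulr_sumr -big_split /= big_seq [leRHS]big_seq.
  by apply: ler_sum => b; exact: far.
set S := \sum_(b <- _) _ in h *; set W := walk_length _ in h *.
have -> : 2 / V%:R * S + 3 * W = (2 * S + V%:R * (2 * W)) / V%:R + W.
  by field; rewrite gt_eqF.
by rewrite lerD2r ler_pdivlMr// mulrC.
Qed.

Lemma short_route_le (D : R) s : (forall b, b \in s -> d b 0 <= D) -> 0 <= D ->
  closed_length d (0 :: s) <= 2 * D + walk_length s.
Proof.
case: s => [|a s] hD D0 /=.
  have := dist_last_path 0 [::] => /= h; rewrite !addr0.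
  by apply: le_trans h _; rewrite mulr_ge0.
rewrite -cats1 path_length_cat /= addr0.
have h1 : d a 0 <= D by apply: hD; rewrite mem_head.
have h2 : d (last a s) 0 <= D by apply: hD; rewrite mem_last.
rewrite (dC 0 a); lra.
Qed.

(** The walk through [l] is cut into batches of [V] consecutive points. Only the
last batch can be incomplete, and its way from and to the depot accounts for
[2 * D]. *)
Lemma chop_routes (I : Type) (y : I -> R * R) V (D : R) (l : seq I) : (0 < V)%N ->
  0 <= D -> (forall b, b \in map y l -> d b 0 <= D) ->
  exists rs : seq (seq I), [/\ all (fun r => (size r <= V)%N) rs, flatten rs = l &
    \sum_(r <- rs) closed_length d (0 :: map y r) <=
      2 / V%:R * (\sum_(i <- l) d (y i) 0) + 3 * walk_length (map y l) + 2 * D].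
Proof.
move=> V0 D0; have [k] := ubnP (size l); elim: k l => // k IHk l lk hD.
have V2 : 0 <= 2 / V%:R :> R by rewrite divr_ge0.
have [lV|Vl] := leqP (size l) V.
  exists [:: l]; split; rewrite /= ?lV ?cats0// big_seq1.
  apply: le_trans (short_route_le hD D0) _.
  rewrite addrC lerD2r.
  have w0 : 0 <= walk_length (map y l) by case: (map y l) => //= *; exact: path_length_ge0.
  have s0 : 0 <= \sum_(i <- l) d (y i) 0 by rewrite sumr_ge0.
  by have := mulr_ge0 V2 s0; lra.
have sz : size (drop V l) = (size l - V)%N by rewrite size_drop.
have lE := cat_take_drop V l.
have hD2 b : b \in map y (drop V l) -> d b 0 <= D.
  by move=> hb; apply: hD; rewrite -lE map_cat mem_cat hb orbT.
have [|rs [rs1 rs2 rs3]] := IHk (drop V l) _ hD2; first by rewrite sz; lia.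
exists (take V l :: rs); split.
- by rewrite /= rs1 andbT size_take Vl.
- by rewrite /= rs2 lE.
rewrite big_cons.
have sV : size (map y (take V l)) = V by rewrite size_map size_take Vl.
have h := full_route_le V0 sV.
have := walk_length_cat (map y (take V l)) (map y (drop V l)).
rewrite -map_cat lE => hw.
have -> : \sum_(i <- l) d (y i) 0 =
    \sum_(i <- take V l) d (y i) 0 + \sum_(i <- drop V l) d (y i) 0.
  by rewrite -[in LHS]lE big_cat.
rewrite big_map in h; rewrite mulrDr.
lra.
Qed.

End routing.

(** * Routing the points of a bounded region *)

Section route_lengths.
Variables (R : realType) (d : R * R -> R * R -> R).
Hypothesis hd : planar_metric d.

Section finite_sets.
Variables (I : finType) (y : I -> R * R) (V : nat).
Hypothesis V0 : (0 < V)%N.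

Let plans (A : {set I}) := [set rs : seq (seq I) |
  all (fun r => (size r <= V)%N) rs /\ flatten rs =i A].

Let plan_cost (rs : seq (seq I)) :=
  \sum_(r <- rs) closed_length d (0 :: map y r).

Let plan_cost_ge0 rs : 0 <= plan_cost rs.
Proof. by apply: sumr_ge0 => r _; exact: closed_length_ge0. Qed.

Let singletons (A : {set I}) : plans A [seq [:: i] | i <- enum A].
Proof.
split; first by apply/allP => r /mapP[i _ ->].
have -> : flatten [seq [:: i] | i <- enum A] = enum A.
  by elim: (enum A) => //= i l ->.
by move=> i; rewrite mem_enum.
Qed.

Lemma cvrp_length_ge0 (A : {set I}) : 0 <= cvrp_length d y V A.
Proof.
apply: lb_le_inf; last by move=> _ [rs _ <-]; exact: plan_cost_ge0.
by eexists; exists [seq [:: i] | i <- enum A]; [exact: singletons|reflexivity].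
Qed.

(** The radial lower bound of Haimovich and Rinnooy Kan: a route is at least as
long as twice the mean distance of its points, of which there are at most [V]. *)
Lemma cvrp_length_ge :
  2 / V%:R * (\sum_i d (y i) 0) <= cvrp_length d y V [set: I]%SET.
Proof.
apply: lb_le_inf.
  by eexists; exists [seq [:: i] | i <- enum [set: I]%SET];
    [exact: singletons|reflexivity].
move=> _ [rs [/allP rsV rsE] <-].
rewrite mulrAC ler_pdivrMr ?ltr0n// mulrC.
have r0 i : 0 <= d (y i) 0 by case: hd.
apply: (@le_trans _ _ (2 * \sum_(i <- flatten rs) d (y i) 0)).
  rewrite mulrC ler_wpM2l//.
  rewrite (perm_big (undup (flatten rs))) /=; last first.
    apply: uniq_perm; rewrite ?undup_uniq// ?index_enum_uniq// => i.
    by rewrite mem_undup rsE !inE mem_index_enum.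
  elim: (flatten rs) => //= i l IHl; rewrite big_cons.
  case: ifP => _; last by rewrite big_cons lerD2l.
  by apply: le_trans IHl _; rewrite lerDr.
rewrite big_flatten /= mulr_sumr mulr_suml big_seq [leRHS]big_seq.
apply: ler_sum => r rrs; rewrite [leRHS]mulrC.
have := @route_ge_mean _ _ hd V (map y r); rewrite size_map big_map.
by apply; exact: rsV.
Qed.

Lemma cvrp_length_le (D : R) (A : {set I}) (l : seq I) : 0 <= D ->
  (forall i, d (y i) 0 <= D) -> uniq l -> l =i A ->
  cvrp_length d y V A <= 2 / V%:R * (\sum_(i in A) d (y i) 0)
    + 3 * walk_length d (map y l) + 2 * D.
Proof.
move=> D0 hD ul lA.
have [|rs [rs1 rs2 rs3]] := chop_routes hd (y := y) (l := l) V0 D0.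
  by move=> b /mapP[i _ ->].
have -> : \sum_(i in A) d (y i) 0 = \sum_(i <- l) d (y i) 0.
  rewrite -big_enum /=; apply: perm_big; apply: uniq_perm => //.
    exact: enum_uniq.
  by move=> i; rewrite mem_enum lA.
apply: le_trans rs3; apply: ge_inf.
  by exists 0 => _ [? _ <-]; exact: plan_cost_ge0.
by exists rs => //; split=> // i; rewrite rs2 lA.
Qed.

Lemma tsp_length_ge0 : 0 <= tsp_length d y.
Proof.
apply: lb_le_inf; last by move=> _ [s _ <-]; exact: closed_length_ge0.
by eexists; exists (enum I); [exact: perm_refl|reflexivity].
Qed.

Lemma tsp_length_le (D : R) (l : seq I) : (forall i j, d (y i) (y j) <= D) ->
  perm_eq l (enum I) -> 0 <= D -> tsp_length d y <= walk_length d (map y l) + D.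
Proof.
move=> hD pl D0; apply: (@le_trans _ _ (closed_length d (map y l))).
  apply: ge_inf; last by exists l.
  by exists 0 => _ [s _ <-]; exact: closed_length_ge0.
case: l {pl} => [|i l] /=; first by rewrite add0r.
rewrite -cats1 path_length_cat /= addr0 lerD2l last_map; exact: hD.
Qed.

(** Visiting the points cell after cell, a step inside a cell costs at most
[delta], and the steps between cells telescope. *)
Lemma walk_cells (cell : I -> nat) (delta D : R) i l : 0 <= delta -> 0 <= D ->
  (forall i j, cell i = cell j -> d (y i) (y j) <= delta) ->
  (forall i j, d (y i) (y j) <= D) ->
  path (relpre cell leq) i l ->
  path_length d (y i) (map y l) <=
    (size l)%:R * delta + D * ((cell (last i l))%:R - (cell i)%:R).
Proof.
move=> delta0 D0 hdelta hD.
elim: l i => [|j l IHl] i /=; first by rewrite mul0r subrr mulr0 addr0.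
move=> /andP[ij /IHl h].
have hij : d (y i) (y j) <= delta + D * ((cell j)%:R - (cell i)%:R).
  have [e|ne] := eqVneq (cell i) (cell j).
    by rewrite e subrr mulr0 addr0 hdelta.
  apply: le_trans (hD i j) _; rewrite -[leLHS]add0r lerD// -[leLHS]mulr1.
  by rewrite ler_wpM2l// -natrB ?ler1n// subn_gt0 ltn_neqAle ne.
have -> : (size l).+1%:R = (size l)%:R + 1 :> R by rewrite -natr1.
lra.
Qed.

End finite_sets.

Definition in_box (D : R) (a : R * R) := `|a.1| <= D /\ `|a.2| <= D.

Lemma in_box_dist D a b : in_box D a -> in_box D b -> d a b <= 4 * D.
Proof.
move=> [a1 a2] [b1 b2]; case: hd => _ _ _ /(_ a b) h; apply: le_trans h _.
have h1 := ler_normB a.1 b.1; have h2 := ler_normB a.2 b.2; lra.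
Qed.

Lemma in_box_dist0 D a : in_box D a -> d a 0 <= 2 * D.
Proof.
move=> [a1 a2]; case: hd => _ _ _ /(_ a 0) h; apply: le_trans h _.
by rewrite /= !subr0; lra.
Qed.

(** The cells are the squares of side [delta], numbered row by row. *)
Lemma grid_cells (D delta : R) : 0 <= D -> 0 < delta ->
  exists M : nat, exists cell : R * R -> nat,
    (forall a, in_box D a -> (cell a <= M)%N) /\
    (forall a b, in_box D a -> in_box D b -> cell a = cell b ->
      d a b <= 2 * delta).
Proof.
move=> D0 delta0; pose g (t : R) := Num.truncn ((t + D) / delta).
pose G := Num.truncn (2 * D / delta).
have g0 t : `|t| <= D -> 0 <= (t + D) / delta.
  by rewrite ler_norml => /andP[h _]; rewrite divr_ge0 ?(ltW delta0)//; lra.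
have gG t : `|t| <= D -> (g t <= G)%N.
  rewrite ler_norml => /andP[_ h]; apply: le_truncn.
  by rewrite ler_pM2r ?invr_gt0//; lra.
have gE s t : `|s| <= D -> `|t| <= D -> g s = g t -> `|s - t| <= delta.
  move=> /g0 s0 /g0 t0 e; have := truncn_itv s0; have := truncn_itv t0.
  rewrite -/(g s) -/(g t) e -natr1 !ler_pdivlMr// !ltr_pdivrMr//.
  set k := _%:R => /andP[h1 h2] /andP[h3 h4]; rewrite ler_norml.
  by apply/andP; split; lra.
exists (G * G.+1 + G)%N, (fun a => g a.1 * G.+1 + g a.2)%N; split.
  by move=> a [/gG h1 /gG h2]; rewrite leq_add// leq_mul.
move=> a b [a1 a2] [b1 b2] e.
have l1 := gG _ a2; have l2 := gG _ b2.
have e2 : g a.2 = g b.2.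
  have := congr1 (modn^~ G.+1) e; rewrite /= !modnMDl !modn_small// ltnS//.
have e1 : g a.1 = g b.1.
  by move: e; rewrite e2 => /addIn /eqP; rewrite eqn_pmul2r// => /eqP.
case: hd => _ _ _ /(_ a b) h; apply: le_trans h _.
by have := gE _ _ a1 b1 e1; have := gE _ _ a2 b2 e2; lra.
Qed.

(** The walk from cell to cell costs a small constant per point, and a term that
depends on the grid only for the changes of cell. The term [8 * D] leaves room
for the way to the first point and from the last one. *)
Lemma box_walk (D eta : R) : 0 <= D -> 0 < eta ->
  exists n0 : nat, forall n, (n0 <= n)%N -> forall y : 'I_n -> R * R,
    (forall i, in_box D (y i)) -> forall A : {set 'I_n},
    exists l, [/\ uniq l, l =i A &
      3 * walk_length d (map y l) + 8 * D <= n%:R * eta].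
Proof.
move=> D0 eta0.
have delta0 : 0 < eta / 12 by rewrite divr_gt0.
have [M [cell [cellM cellE]]] := grid_cells D0 delta0.
pose C := 3 * (4 * D * M%:R) + 8 * D.
exists (Num.truncn (2 * C / eta)).+1 => n n0n y hy A.
pose l := sort (relpre (cell \o y) leq) (enum A).
have lA : l =i A by move=> i; rewrite mem_sort mem_enum.
have ul : uniq l by rewrite sort_uniq enum_uniq.
exists l; split => //.
have nC : 2 * C <= n%:R * eta.
  rewrite -ler_pdivrMr//; have C0 : 0 <= 2 * C / eta.
    rewrite divr_ge0 ?(ltW eta0)// mulr_ge0// addr_ge0//; last exact: mulr_ge0.
    by rewrite !mulr_ge0.
  have /andP[_ h] := truncn_itv C0; apply: le_trans (ltW h) _.
  by rewrite ler_nat.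
suff : walk_length d (map y l) <= n%:R * (eta / 6) + 4 * D * M%:R.
  by rewrite /C in nC; lra.
have ln : (size l <= n)%N.
  by rewrite size_sort -cardE -[leqRHS]card_ord max_card.
have sl : sorted (relpre (cell \o y) leq) l.
  by apply: sort_sorted => i j /=; exact: leq_total.
have D40 : 0 <= 4 * D by rewrite mulr_ge0.
case: l {lA ul} ln sl => [|i l] ln sl /=.
  by rewrite addr_ge0// mulr_ge0// divr_ge0// ltW.
apply: (le_trans (walk_cells (delta := eta / 6) (D := 4 * D)
  (cell := cell \o y) _ _ _ _ sl)) => //.
- by rewrite divr_ge0// ltW.
- move=> j k /= jk; have := cellE _ _ (hy j) (hy k) jk; lra.
- by move=> j k; exact: in_box_dist.
apply: lerD.
  by rewrite ler_wpM2r ?divr_ge0 ?(ltW eta0)// ler_nat (leq_trans _ ln).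
rewrite ler_wpM2l//= lerBlDr; apply: (@le_trans _ _ M%:R).
  by rewrite ler_nat cellM.
by rewrite lerDl.
Qed.

Lemma cvrp_length_le_box (V : nat) (D eta : R) : (0 < V)%N -> 0 <= D -> 0 < eta ->
  exists n0 : nat, forall n, (n0 <= n)%N -> forall y : 'I_n -> R * R,
    (forall i, in_box D (y i)) -> forall A : {set 'I_n},
    cvrp_length d y V A <=
      2 / V%:R * (\sum_(i in A) d (y i) 0) + n%:R * eta.
Proof.
move=> V0 D0 eta0; have [n0 h] := box_walk D0 eta0.
exists n0 => n n0n y hy A; have [l [ul lA hl]] := h n n0n y hy A.
have D20 : 0 <= 2 * D by rewrite mulr_ge0.
apply: le_trans (cvrp_length_le V0 D20 _ ul lA) _.
  by move=> i; exact: in_box_dist0.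
by lra.
Qed.

Lemma tsp_length_le_box (D eta : R) : 0 <= D -> 0 < eta ->
  exists n0 : nat, forall n, (n0 <= n)%N -> forall y : 'I_n -> R * R,
    (forall i, in_box D (y i)) -> tsp_length d y <= n%:R * eta.
Proof.
move=> D0 eta0; have [n0 h] := box_walk D0 eta0.
exists n0 => n n0n y hy; have [l [ul lA hl]] := h n n0n y hy [set: 'I_n]%SET.
have D40 : 0 <= 4 * D by rewrite mulr_ge0.
apply: (le_trans (@tsp_length_le _ y (4 * D) l _ _ D40)).
- by move=> i j; exact: in_box_dist.
- apply: uniq_perm => //; first exact: enum_uniq.
  by move=> i; rewrite lA mem_enum !inE.
have : 0 <= walk_length d (map y l).
  by case: (map y l) => //= *; exact: path_length_ge0.
lra.
Qed.

End route_lengths.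

(** * Locality of the pick-up dynamics *)

Section removal.
Variable n : nat.
Implicit Types (A : {set 'I_n}) (r : seq ('I_n * nat)).

Lemma serve_sub A x : serve A x \subset A.
Proof. by rewrite /serve; case: ifP => // _; exact: subsetDl. Qed.

Lemma foldl_serve_sub A r : foldl (@serve n) A r \subset A.
Proof.
elim: r A => //= x r IHr A; exact: fintype.subset_trans (IHr _) (serve_sub A x).
Qed.

(** A request is rejected only because something that it asks for is gone:
either way, one of its packages is missing afterwards. *)
Lemma foldl_serve_missing A r i k : (i, k) \in r -> (0 < k <= n)%N ->
  exists2 l, (l < k)%N & forall j : 'I_n, (j == (i + l) %% n :> nat)%N ->
    j \notin foldl (@serve n) A r.
Proof.
move=> /splitPr[r1 r2] /andP[k0 kn]; rewrite foldl_cat /=.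
set A1 := foldl _ A r1; set A2 := serve A1 _.
have [l lk lA2] : exists2 l, (l < k)%N & forall j : 'I_n,
    (j == (i + l) %% n :> nat)%N -> j \notin A2.
  rewrite /A2 /serve /= kn /=; case: ifPn => [_|/fintype.subsetPn[j]].
    exists 0%N => // j /eqP ji; rewrite inE negb_and negbK inE.
    by apply/orP; left; apply/existsP; exists (Ordinal k0); rewrite /= ji.
  move=> /[!inE] /existsP[l /eqP lj] jA1; exists (val l).
    exact: ltn_ord.
  move=> j' /eqP j'j.
  by rewrite (_ : j' = j)//; apply: val_inj; rewrite /= j'j lj.
exists l => // j /lA2; apply: contra; exact: (fintype.subsetP (foldl_serve_sub A2 r2)).
Qed.

End removal.

(** The dynamics on the integers, where nothing wraps around: the common
reference to which circles of different sizes are compared. *)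
Definition line_serve (X : pred nat) (x : nat * nat) : pred nat :=
  fun c => X c && ~~ (all X (iota x.1 x.2) && (x.1 <= c < x.1 + x.2)%N).

Section unrolling.
Variables (n a : nat).
Hypothesis n_gt0 : (0 < n)%N.

(** Along the circle, from location [a] on, packages are numbered from 0. *)
Definition unroll c : 'I_n := Ordinal (ltn_pmod (a + c) n_gt0).
Definition coord (i : 'I_n) : nat := ((i + (n - a %% n)) %% n)%N.

Lemma coord_lt i : (coord i < n)%N. Proof. exact: ltn_pmod. Qed.

Lemma coordK i : unroll (coord i) = i.
Proof.
apply: val_inj; rewrite /= /coord modnDmr -modnDml.
have an : (a %% n < n)%N by rewrite ltn_pmod.
have -> : (a %% n + (i + (n - a %% n)) = i + n)%N by lia.
by rewrite modnDr modn_small.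
Qed.

Lemma unrollK c : (c < n)%N -> coord (unroll c) = c.
Proof.
move=> cn; rewrite /coord /= modnDml -addnA -modnDml.
have an : (a %% n < n)%N by rewrite ltn_pmod.
have -> : (a %% n + (c + (n - a %% n)) = c + n)%N by lia.
by rewrite modnDr modn_small.
Qed.

(** The last disjunct is that of a request that goes past the end of the circle. *)
Lemma requested_unroll u k c : (u < n)%N -> (c < n)%N -> (k <= n)%N ->
  (unroll c \in requested (unroll u) k) = (u <= c < u + k)%N || (c + n < u + k)%N.
Proof.
move=> un cn kn; rewrite inE; apply/existsP/idP => [[l /eqP]|].
  rewrite /= modnDml => e; have lk := ltn_ord l.
  have : (u + l = c %[mod n])%N.
    by apply/eqP; rewrite -(eqn_modDl a) addnA; apply/eqP.
  rewrite (modn_small cn) => {}e.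
  have [h|h] := ltnP (u + l) n.
    by rewrite (modn_small h) in e; lia.
  have : (u + l = n + (u + l - n))%N by lia.
  by move=> e'; rewrite e' modnDl modn_small in e; lia.
move=> h; suff [l lk e] : exists2 l, (l < k)%N & (u + l = c %[mod n])%N.
  exists (Ordinal lk); rewrite /= modnDml -addnA.
  by rewrite eqn_modDl; apply/eqP.
case/orP: h => h; first by exists (c - u)%N; [lia|congr (_ %% _)%N; lia].
exists (c + n - u)%N; first lia.
by rewrite (_ : u + _ = c + n)%N; [rewrite modnDr|lia].
Qed.

(** The zone is the arc [zl <= c < zr]. When no request comes from the [m]
locations before it nor from its last [m] locations, every request is [inner] or
[outer]. *)
Variables (m zl zr : nat).
Hypotheses (m_gt0 : (0 < m)%N) (mzl : (m <= zl)%N).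
Hypotheses (zrn : (zr <= n)%N) (mn : (m <= n)%N).

Definition inner u := ((zl <= u) && (u + m <= zr))%N.
Definition outer u := ((u + m <= zl) || (zr <= u))%N.

Lemma serve_outer A u k c : (u < n)%N -> outer u -> (k <= m)%N ->
  (zl <= c < zr)%N -> (unroll c \in serve A (unroll u, k)) = (unroll c \in A).
Proof.
move=> un ou km /andP[zlc czr]; rewrite /serve; case: ifP => //= _.
rewrite inE requested_unroll//; [|lia|lia].
by have /negbTE -> : ~~ ((u <= c < u + k) || (c + n < u + k))%N; [move/orP: ou; lia|].
Qed.

Lemma serve_inner A u k c : inner u -> (k <= m)%N -> (zl <= c < zr)%N ->
  (unroll c \in serve A (unroll u, k)) =
  (unroll c \in A) && ~~ (all (fun c' => unroll c' \in A) (iota u k) &&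
                          (u <= c < u + k)%N).
Proof.
move=> /andP[zlu uzr] km /andP[zlc czr].
have req c' : (c' < n)%N ->
    (unroll c' \in requested (unroll u) k) = (u <= c' < u + k)%N.
  move=> c'n; rewrite requested_unroll//; [|lia|lia].
  by have /negbTE -> : ~~ (c' + n < u + k)%N; [lia|rewrite orbF].
have sub : (requested (unroll u) k \subset A) =
    all (fun c' => unroll c' \in A) (iota u k).
  apply/fintype.subsetP/allP => [h c'|h i ireq].
    by rewrite mem_iota => hc'; apply: h; rewrite req; lia.
  rewrite -(coordK i); apply: h; rewrite mem_iota -req ?coord_lt//.
  by rewrite coordK.
rewrite /serve /= (leq_trans km mn) sub /=.
case: ifP => _ /=; last by rewrite andbT.
by rewrite finset.in_setD req; [exact: andbC|lia].
Qed.

(** A request from before the zone is too short to reach it, and so is one from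
after it, which would have to go round the circle and reach beyond the first [m]
packages; the inner requests never leave the zone. *)
Lemma foldl_serve_line (r : seq ('I_n * nat)) (A : {set 'I_n}) (X : pred nat) :
  (forall x, x \in r -> (x.2 <= m)%N && (inner (coord x.1) || outer (coord x.1))) ->
  (forall c, (zl <= c < zr)%N -> (unroll c \in A) = X c) ->
  forall c, (zl <= c < zr)%N -> (unroll c \in foldl (@serve n) A r) =
    foldl line_serve X
      [seq (coord x.1, x.2) | x <- r & inner (coord x.1)] c.
Proof.
elim: r A X => [|[i k] r IHr] A X hr hA c hc /=; first exact: hA.
have hr' x : x \in r ->
    (x.2 <= m)%N && (inner (coord x.1) || outer (coord x.1)).
  by move=> xr; apply: hr; rewrite inE xr orbT.
have /andP[/= km io] := hr _ (mem_head _ _).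
case: ifPn io => [inn _|_ /= out]; apply: IHr => // c' hc'; last first.
  by rewrite -[i]coordK serve_outer ?coord_lt// hA.
rewrite -[i]coordK serve_inner // coordK hA// /line_serve /=.
congr (_ && ~~ (_ && _)); apply: eq_in_all => c''.
rewrite mem_iota => hc''; apply: hA; move/andP: inn; lia.
Qed.

End unrolling.

Section chronology.
Variables (R : realType) (n : nat).
Variables (S : 'I_n -> nat -> R) (M : 'I_n -> nat -> nat) (t : R).

Definition points := [set q : 'I_n * nat | S q.1 q.2 <= t].
Definition chron := sort (fun q q' => S q.1 q.2 <= S q'.1 q'.2)
  (enum_fset (fset_set points)).

Lemma availableE : available S M t =
  foldl (@serve n) [set: 'I_n]%SET [seq (q.1, M q.1 q.2) | q <- chron].
Proof. by []. Qed.

Hypothesis fin : finite_set points.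

Lemma mem_chron q : (q \in chron) = (S q.1 q.2 <= t).
Proof.
rewrite mem_sort; have := in_fset_set fin q => h.
by rewrite [LHS]h; apply/idP/idP; rewrite inE.
Qed.

Hypothesis inj : forall q q' : 'I_n * nat, S q.1 q.2 = S q'.1 q'.2 -> q = q'.

(** Without ties, the chronological order is strict, hence determined by the
arrival times alone. *)
Lemma chron_sorted : sorted (fun q q' => S q.1 q.2 < S q'.1 q'.2) chron.
Proof.
pose f (q : 'I_n * nat) := S q.1 q.2.
have := sort_sorted (leT := relpre f <=%R) (fun q q' => le_total (f q) (f q'))
  (enum_fset (fset_set points)).
rewrite -[sort _ _]/chron => h.
suff : sorted (relpre f <%R) chron by [].
rewrite -sorted_map lt_sorted_uniq_le sorted_map h andbT map_inj_uniq//.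
by rewrite sort_uniq fset_uniq.
Qed.

End chronology.

(** Both circles are compared to the line. The inner requests are the same, and
are processed in the same order, since a strictly sorted list is determined by
its elements. *)
Lemma available_local (R : realType) (n N a b m zl zr : nat)
  (n0 : (0 < n)%N) (N0 : (0 < N)%N)
  (S : 'I_n -> nat -> R) (M : 'I_n -> nat -> nat)
  (S' : 'I_N -> nat -> R) (M' : 'I_N -> nat -> nat) (t : R) :
  (0 < m)%N -> (m <= zl)%N -> (zr <= n)%N -> (m <= n)%N -> (zr <= N)%N -> (m <= N)%N ->
  finite_set (points S t) -> finite_set (points S' t) ->
  (forall q q' : 'I_n * nat, S q.1 q.2 = S q'.1 q'.2 -> q = q') ->
  (forall q q' : 'I_N * nat, S' q.1 q.2 = S' q'.1 q'.2 -> q = q') ->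
  (forall i j, (M i j <= m)%N) -> (forall i j, (M' i j <= m)%N) ->
  (forall u j, (u < zr)%N -> S (unroll a n0 u) j = S' (unroll b N0 u) j) ->
  (forall u j, (u < zr)%N -> M (unroll a n0 u) j = M' (unroll b N0 u) j) ->
  (forall u j, (zl <= u + m < zl + m)%N || (zr <= u + m < zr + m)%N ->
    t < S (unroll a n0 u) j) ->
  forall c, (zl <= c < zr)%N ->
    (unroll a n0 c \in available S M t) = (unroll b N0 c \in available S' M' t).
Proof.
move=> m0 mzl zrn mn zrN mN fin fin' inj inj' hM hM' SS' MM' closed c hc.
pose L n (a : nat) (S : 'I_n -> nat -> R) :=
  [seq (coord a q.1, q.2) | q <- chron S t & inner m zl zr (coord a q.1)].
have line k e (k0 : (0 < k)%N) (Sk : 'I_k -> nat -> R) (Mk : 'I_k -> nat -> nat) :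
    (m <= k)%N -> (zr <= k)%N -> finite_set (points Sk t) ->
    (forall i j, (Mk i j <= m)%N) ->
    (forall u j, (zl <= u + m < zl + m)%N || (zr <= u + m < zr + m)%N ->
      (u < zr)%N -> t < Sk (unroll e k0 u) j) ->
    (unroll e k0 c \in available Sk Mk t) =
    foldl line_serve predT [seq (q.1, Mk (unroll e k0 q.1) q.2) | q <- L k e Sk] c.
  move=> mk zrk fk hk cl; rewrite availableE.
  rewrite (@foldl_serve_line k e k0 m zl zr m0 mzl zrk mk _ _ predT) //.
  - congr (foldl _ _ _ _); rewrite /L filter_map -!map_comp.
    by apply: eq_map => q /=; rewrite coordK.
  - move=> x /mapP[q qc ->] /=; rewrite hk /=.
    move: qc; rewrite mem_chron// -(coordK e k0 q.1) /inner /outer => qt.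
    rewrite coordK; have [] := boolP
      ((zl <= coord e q.1 + m < zl + m)%N || (zr <= coord e q.1 + m < zr + m)%N).
      by move=> /cl h; have := h q.2 _; rewrite ltNge qt; lia.
    lia.
  - by move=> c' _; rewrite inE.
rewrite (line _ a n0)//; last by move=> u j hu _; exact: closed.
rewrite (line _ b N0)//; last by move=> u j hu uzr; rewrite -SS'//; exact: closed.
have srt k e (k0 : (0 < k)%N) (Sk : 'I_k -> nat -> R) :
    (forall q q' : 'I_k * nat, Sk q.1 q.2 = Sk q'.1 q'.2 -> q = q') ->
    sorted (fun q q' : nat * nat =>
      Sk (unroll e k0 q.1) q.2 < Sk (unroll e k0 q'.1) q'.2) (L k e Sk).
  move=> ik; rewrite /L sorted_map /=.
  have tr : transitive (fun q q' : 'I_k * nat => Sk q.1 q.2 < Sk q'.1 q'.2).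
    by move=> q q' q''; exact: lt_trans.
  have := sorted_filter tr (fun q => inner m zl zr (coord e q.1)) (chron_sorted t ik).
  by apply: sub_sorted => q q' /=; rewrite !coordK.
have memL k e (k0 : (0 < k)%N) (Sk : 'I_k -> nat -> R) : finite_set (points Sk t) ->
    (zr <= k)%N -> forall u j, ((u, j) \in L k e Sk) =
      inner m zl zr u && (Sk (unroll e k0 u) j <= t).
  move=> fk zrk u j; apply/mapP/andP => [[q]|[iu hj]].
    by rewrite mem_filter mem_chron// => /andP[iq qt] [-> ->]; rewrite coordK.
  have uk : (u < k)%N by move/andP: (iu); lia.
  exists (unroll e k0 u, j); last by rewrite /= unrollK.
  by rewrite mem_filter /= unrollK// iu mem_chron.
have Lzr k e (Sk : 'I_k -> nat -> R) u j : (u, j) \in L k e Sk -> (u < zr)%N.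
  by move=> /mapP[q]; rewrite mem_filter => /andP[/andP[h1 h2] _] [-> _]; lia.
have -> : L n a S = L N b S'.
  pose lt (q q' : nat * nat) := S (unroll a n0 q.1) q.2 < S (unroll a n0 q'.1) q'.2.
  apply: (@irr_sorted_eq _ lt).
  - by move=> ? ? ?; exact: lt_trans.
  - by move=> ?; rewrite /lt ltxx.
  - exact: srt.
  - have := srt N b N0 S' inj'.
    apply: (@sub_in_sorted _ [in L N b S']) => [[u j] [u' j']|]; last exact/allP.
    by move=> /Lzr uzr /Lzr uzr' /=; rewrite /lt /= !SS'.
  move=> [u j]; rewrite memL// memL//; case: (boolP (inner _ _ _ _)) => //= iu.
  by rewrite SS'//; move/andP: iu; lia.
congr (foldl _ _ _ _); apply/eq_in_map => -[u j] /Lzr uzr /=.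
by rewrite MM'.
Qed.

(** * Measurability of the set of available packages *)

Section countable_valued.
Context {d : measure_display} {T : measurableType d}.

(** Measurability of a map into a countable type, such as lists or finite sets,
that is viewed as discrete. *)
Definition measurable_fibers (C : Type) (f : T -> C) :=
  forall v, measurable (f @^-1` [set v]).

Lemma fibers_preimage (C : countType) (f : T -> C) (Q : set C) :
  measurable_fibers f -> measurable (f @^-1` Q).
Proof.
move=> mf; rewrite (_ : f @^-1` Q =
    \bigcup_(v in [set: C]) (if `[< Q v >] then f @^-1` [set v] else set0)).
  apply: countable_bigcupT_measurable; first exact: countableP.
  by move=> v; case: ifP.
apply/seteqP; split => [w Qw|w [v _]] /=.
  by exists (f w) => //=; case: asboolP.
by case: asboolP => // Qv ->.
Qed.

Lemma fibers_bind (C : countType) (D : Type) (f : T -> C) (g : C -> T -> D) :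
  measurable_fibers f -> (forall c, measurable_fibers (g c)) ->
  measurable_fibers (fun w => g (f w) w).
Proof.
move=> mf mg v; rewrite (_ : _ @^-1` _ =
    \bigcup_(c in [set: C]) (f @^-1` [set c] `&` g c @^-1` [set v])).
  apply: countable_bigcupT_measurable; first exact: countableP.
  by move=> c; apply: measurableI; [exact: mf|exact: mg].
by apply/seteqP; split => [w gv|w [c _ [/= -> ->]]] //; exists (f w).
Qed.

Lemma fibers_cst (C : Type) (c : C) : measurable_fibers (fun=> c).
Proof.
move=> v; have [->|h] := pselect (c = v).
  by rewrite (_ : _ @^-1` _ = setT)//; apply/seteqP; split.
by rewrite (_ : _ @^-1` _ = set0)//; apply/seteqP; split.
Qed.

Lemma fibers_comp (C : countType) (D : Type) (f : T -> C) (g : C -> D) :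
  measurable_fibers f -> measurable_fibers (g \o f).
Proof. by move=> mf v; exact: (fibers_preimage (g @^-1` [set v]) mf). Qed.

Lemma fibers_map (I : Type) (C : countType) (f : I -> T -> C) (l : seq I) :
  (forall i, measurable_fibers (f i)) ->
  measurable_fibers (fun w => [seq f i w | i <- l]).
Proof.
move=> mf; elim: l => [|i l IHl]; first exact: fibers_cst.
have h : measurable_fibers (fun w => (fun c w => c :: [seq f j w | j <- l]) (f i w) w).
  apply: (@fibers_bind C (seq C) (f i)
    (fun c w => c :: [seq f j w | j <- l])) => // c.
  exact: (@fibers_comp (seq C) (seq C) _ (cons c)).
exact: h.
Qed.

Lemma fibers_bool (f : T -> bool) :
  measurable_fun setT f -> measurable_fibers f.
Proof. by move=> mf b; rewrite -[_ @^-1` _]setTI; exact: mf. Qed.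

End countable_valued.

Lemma eq_sort_in (T : eqType) (r r' : rel T) (s : seq T) :
  {in s &, r =2 r'} -> sort r s = sort r' s.
Proof.
move=> rr'; have /all_sigP[s' sE] : all [in s] s by apply/allP.
rewrite [in LHS]sE [in RHS]sE !sort_map; congr (map _ (sort _ _)).
by apply/funext => -[x xs]; apply/funext => -[y ys]; exact: rr'.
Qed.

Section measurable_available.
Context {d : measure_display} {T : measurableType d} {R : realType}.
Variables (n : nat) (S : 'I_n -> nat -> T -> R) (M : 'I_n -> nat -> T -> nat).
Hypothesis mS : forall i j, measurable_fun setT (S i j).
Hypothesis mM : forall i j, measurable_fibers (M i j).
Variable t : R.

Let pts w := points (fun i j => S i j w) t.

Let fibers_before (q q' : 'I_n * nat) :
  measurable_fibers (fun w => S q.1 q.2 w <= S q'.1 q'.2 w).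
Proof. by apply: fibers_bool; exact: measurable_fun_ler. Qed.

Lemma measurable_points_eq (B : {fset 'I_n * nat}) :
  measurable [set w | pts w = [set` B]].
Proof.
rewrite (_ : [set w | _] =
    \bigcap_(q in [set: 'I_n * nat]) [set w | (S q.1 q.2 w <= t) = (q \in B)]).
  rewrite -[X in measurable X]setCK setC_bigcap; apply: measurableC.
  apply: countable_bigcupT_measurable => [|q]; first exact: countableP.
  apply: measurableC; have h : measurable_fibers (fun w => S q.1 q.2 w <= t).
    by apply: fibers_bool; exact: measurable_fun_ler.
  exact: h.
apply/seteqP; split => [w /= e q _ /=|w /= h].
  have e1 : pts w q <-> [set` B] q by rewrite e.
  by apply/idP/idP => h; [exact: e1.1|exact: e1.2].
by apply/seteqP; split => q /=; rewrite /pts /points /= (h q).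
Qed.

(** [fset_set] sends every infinite set to the empty one, so that the fibre of the
empty set also contains the event that there are infinitely many points. *)
Lemma fibers_points : measurable_fibers (fun w => fset_set (pts w)).
Proof.
pose inf := ~` \bigcup_(B in [set: {fset 'I_n * nat}]) [set w | pts w = [set` B]].
have minf : measurable inf.
  apply: measurableC; apply: countable_bigcupT_measurable; first exact: countableP.
  exact: measurable_points_eq.
move=> B; rewrite (_ : _ @^-1` _ = [set w | pts w = [set` B]] `|`
    (if B == fset0 then inf else set0)).
  apply: measurableU; first exact: measurable_points_eq.
  by case: ifP.
apply/seteqP; split => w /=.
  move=> e; have [fw|iw] := pselect (finite_set (pts w)).
    by left; rewrite -e fset_setK.
  have e0 : fset_set (pts w) = fset0.
    by rewrite /fset_set; case: pselect.
  right; rewrite -e e0 eqxx => -[C _ /= wC]; apply: iw.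
  by rewrite wC; exact: finite_fset.
case=> [->|]; first by rewrite set_fsetK.
case: eqP => [->|//] wi; rewrite /fset_set; case: pselect => // fw.
by exfalso; apply: wi; exists (fset_set (pts w)) => //=; rewrite fset_setK.
Qed.

(** The sorted list is a function of the outcomes of finitely many comparisons. *)
Lemma fibers_sort (s : seq ('I_n * nat)) : measurable_fibers (fun w =>
  sort (fun q q' => S q.1 q.2 w <= S q'.1 q'.2 w) s).
Proof.
pose ss := [seq (q, q') | q <- s, q' <- s].
pose bs w := [seq S x.1.1 x.1.2 w <= S x.2.1 x.2.2 w | x <- ss].
have mbs : measurable_fibers bs by apply: fibers_map => x; exact: fibers_before.
rewrite (_ : (fun w => _) =
  (fun b => sort (fun q q' => (q, q') \in mask b ss) s) \o bs).
  exact: fibers_comp.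
apply/funext => w /=; apply: eq_sort_in => q q' qs q's.
rewrite /bs -filter_mask mem_filter /= (_ : _ \in ss) ?andbT//.
by apply/allpairsP; exists (q, q').
Qed.

Lemma fibers_chron : measurable_fibers (fun w => chron (fun i j => S i j w) t).
Proof.
exact: (fibers_bind (g := fun B : {fset 'I_n * nat} => fun w =>
  sort (fun q q' => S q.1 q.2 w <= S q'.1 q'.2 w) (enum_fset B)) fibers_points
  (fun B => fibers_sort _)).
Qed.

Lemma fibers_available : measurable_fibers (fun w =>
  available (fun i j => S i j w) (fun i j => M i j w) t).
Proof.
apply: (fibers_bind (g := fun c w => foldl (@serve n) [set: 'I_n]%SET
  [seq (q.1, M q.1 q.2 w) | q <- c]) fibers_chron) => c.
apply: (@fibers_comp _ _ (seq ('I_n * nat)) _ (fun w => [seq (q.1, M q.1 q.2 w) | q <- c])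
  (foldl (@serve n) [set: 'I_n]%SET)).
apply: fibers_map => q; exact: (@fibers_comp _ _ nat _ (M q.1 q.2) (pair q.1)).
Qed.

Lemma measurable_mem_available c : measurable [set w |
  c \in available (fun i j => S i j w) (fun i j => M i j w) t].
Proof.
exact: (fibers_preimage [set A : {set 'I_n} | c \in A] fibers_available).
Qed.

End measurable_available.

(** * Independent families of events *)

Section cylinders.
Context {d : measure_display} {T : measurableType d} {R : realType}.
Variables (Key : choiceType) (C : Key -> set_system T).
Hypothesis CT : forall k, C k setT.
Hypothesis CI : forall k, setI_closed (C k).
Hypothesis mC : forall k, C k `<=` measurable.

Let cylinder := [set X : set T | exists (J : seq Key) (B : Key -> set T),
  [/\ forall k, C k (B k), forall k, k \notin J -> B k = setT &
      X = \bigcap_k B k]].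

Let cylinderE J (B : Key -> set T) : (forall k, k \notin J -> B k = setT) ->
  \bigcap_k B k = \bigcap_(k in [set` undup J]) B k.
Proof.
move=> hB; apply/seteqP; split => w /= hw k hk; first exact: hw.
have [kJ|/hB ->//] := boolP (k \in J).
by apply: hw; rewrite /= mem_undup.
Qed.

(** The intersections of finitely many events, at most one from each [C k], form a
pi-system. *)
Lemma measure_unique_cylinders (m1 m2 : {measure set T -> \bar R}) :
  (m1 setT < +oo)%E ->
  (forall (J : seq Key) (B : Key -> set T), uniq J ->
    (forall k, k \in J -> C k (B k)) ->
    m1 (\bigcap_(k in [set` J]) B k) = m2 (\bigcap_(k in [set` J]) B k)) ->
  forall A, <<s \bigcup_k C k >> A -> m1 A = m2 A.
Proof.
move=> m1oo m12 A sA.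
apply: (@g_sigma_algebra_measure_unique _ R T cylinder _ (fun=> setT)) => //.
- move=> X [J [B [hC hB ->]]]; rewrite (cylinderE hB).
  apply: fin_bigcap_measurable; first exact: finite_seq.
  by move=> k _; apply: mC; exact: hC.
- by move=> _; exists [::], (fun=> setT); split => //; rewrite bigcapT.
- by rewrite bigcup_const//; exists 0%N.
- move=> X Y [J [B [hC hB ->]]] [J' [B' [hC' hB' ->]]].
  exists (J ++ J'), (fun k => B k `&` B' k); split.
  + by move=> k; exact: CI.
  + move=> k; rewrite mem_cat negb_or => /andP[kJ kJ'].
    by rewrite hB// hB'// setTI.
  + by rewrite bigcapI.
- move=> X [J [B [hC hB ->]]]; rewrite (cylinderE hB).
  by apply: m12; [exact: undup_uniq|move=> k _; exact: hC].
move: A sA; apply: sub_sigma_algebra2 => X [k _ Xk].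
exists [:: k], (fun k' => if k' == k then X else setT); split.
- by move=> k'; case: eqP => [->|].
- by move=> k'; rewrite inE; case: eqP.
apply/seteqP; split => [w Xw k' _|w hw]; first by case: ifP.
by have := hw k I; rewrite eqxx.
Qed.

End cylinders.

Section independence.
Context {R : realType} {d : measure_display} {T : measurableType d}.
Variable P : probability T R.

Lemma mutually_independent_inj (I J : choiceType) (f : I -> J)
  (G : J -> set_system T) : injective f -> mutually_independent P G ->
  mutually_independent P (fun i => G (f i)).
Proof.
move=> fI hG s E us hE.
pose E' j := if pselect (exists i, f i = j) is left h then E (projT1 (cid h)) else setT.
have E'E i : E' (f i) = E i.
  rewrite /E'; case: pselect => [h|]; last by case; exists i.
  by congr E; apply: fI; case: (cid h).
have -> : \bigcap_(i in [set` s]) E i = \bigcap_(j in [set` map f s]) E' j.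
  apply/seteqP; split => w hw.
    by move=> _ /mapP[i si ->]; rewrite E'E; exact: hw.
  by move=> i si; rewrite -E'E; apply: hw; exact: map_f.
rewrite hG ?map_inj_uniq// => [|_ /mapP[i si ->]]; last by rewrite E'E; exact: hE.
by rewrite big_map; apply: eq_bigr => i _; rewrite E'E.
Qed.

Lemma mutually_independent_sub (I : eqType) (G H : I -> set_system T) :
  (forall i, H i `<=` G i) -> mutually_independent P G ->
  mutually_independent P H.
Proof. by move=> HG hG s E us hE; apply: hG => // i si; exact/HG/hE. Qed.

(** On the sigma-algebra generated by the other indices, the measures
[P (A `&` _)] and [P A * P _] coincide, since they do so on cylinders. *)
Lemma independent_of_others (I : choiceType) (G : I -> set_system T) (i0 : I)
  (A B : set T) :
  (forall i, G i setT) -> (forall i, setI_closed (G i)) ->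
  (forall i, G i `<=` measurable) -> mutually_independent P G ->
  G i0 A -> <<s \bigcup_(i in [set i | i != i0]) G i >> B ->
  P (A `&` B) = (P A * P B)%E.
Proof.
move=> GT GI mG indep GA sB.
have mA := mG _ _ GA.
have PA0 : 0 <= fine (P A) by rewrite fine_ge0.
pose r := NngNum PA0.
pose C i := if i == i0 then [set setT] else G i.
suff : mrestr P mA B = mscale r P B.
  by rewrite /mrestr /mscale /= setIC => ->; rewrite fineK ?fin_num_measure.
apply: (@measure_unique_cylinders _ _ _ I C) => //.
- by move=> i; rewrite /C; case: ifP.
- by move=> i; rewrite /C; case: ifP => // _ X Y /= -> ->; rewrite setTI.
- by move=> i; rewrite /C; case: ifP => // _ X /= ->; exact: measurableT.
- by rewrite /= /mrestr setTI (le_lt_trans (probability_le1 P mA))// ltry.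
- move=> J E uJ hE; rewrite /= /mrestr /mscale /= fineK ?fin_num_measure//.
  pose J' := rem i0 J.
  pose E' i := if i == i0 then A else E i.
  have EJ : \bigcap_(i in [set` J]) E i = \bigcap_(i in [set` J']) E i.
    apply/seteqP; split => w hw i /= iJ; first exact: hw (mem_rem iJ).
    have [ii0|ii0] := eqVneq i i0; last first.
      by apply: hw; rewrite /= mem_rem_uniq// inE ii0.
    by have := hE _ iJ; rewrite /C ii0 eqxx => ->.
  have i0J' : i0 \notin J' by rewrite mem_rem_uniqF.
  have uJ' : uniq J' by exact: rem_uniq.
  have GE i : i \in J' -> G i (E i).
    move=> iJ'; have := hE i (mem_rem iJ'); rewrite /C.
    by case: eqP => // ii0; rewrite -ii0 iJ' in i0J'.
  have E'E i : i \in J' -> E' i = E i.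
    by rewrite /E'; case: eqP => // ->; rewrite (negbTE i0J').
  have -> : (\bigcap_(i in [set` J]) E i) `&` A = \bigcap_(i in [set` i0 :: J']) E' i.
    rewrite EJ; apply/seteqP; split => [w [hw Aw] i|w hw].
      rewrite /= inE => /predU1P[->|iJ']; first by rewrite /E' eqxx.
      by rewrite E'E//; exact: hw.
    split; last by have := hw i0; rewrite /= mem_head /E' eqxx; exact.
    by move=> i iJ'; rewrite -E'E//; apply: hw; rewrite /= inE [i \in J']iJ' orbT.
  rewrite indep; first last.
  - move=> i; rewrite inE => /predU1P[->|iJ']; first by rewrite /E' eqxx.
    by rewrite E'E//; exact: GE.
  - by rewrite /= i0J'.
  rewrite big_cons {1}/E' eqxx EJ indep//; congr (_ * _)%E.
  by apply: eq_big_seq => i /E'E ->.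
move: B sB; apply: sub_sigma_algebra2 => X [i /= ii0 GX]; exists i => //.
by rewrite /C (negbTE ii0).
Qed.

End independence.

Section law_transfer.
Context {R : realType} {d : measure_display} {T : measurableType d}.
Variable P : probability T R.
Variables (E : pointedType) (Key : choiceType) (C : Key -> set_system E).
Hypothesis CT : forall k, C k setT.
Hypothesis CI : forall k, setI_closed (C k).

Let E' : measurableType _ := g_sigma_algebraType (\bigcup_k C k).

Lemma measurable_configuration (X : T -> E) :
  (forall k B, C k B -> measurable (X @^-1` B)) ->
  measurable_fun setT (X : T -> E').
Proof.
move=> mX; apply: (@measurability _ _ T E' setT X (\bigcup_k C k)) => // _ [B [k _ kB] <-].
by rewrite setTI; exact: mX kB.
Qed.

(** The laws of [X1] and [X2] are two measures that agree on the cylinders, where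
independence reduces them to the marginals. *)
Lemma law_transfer (X1 X2 : T -> E) :
  (forall k B, C k B -> measurable (X1 @^-1` B)) ->
  (forall k B, C k B -> measurable (X2 @^-1` B)) ->
  mutually_independent P (fun k => preimage_set_system setT X1 (C k)) ->
  mutually_independent P (fun k => preimage_set_system setT X2 (C k)) ->
  (forall k B, C k B -> P (X1 @^-1` B) = P (X2 @^-1` B)) ->
  forall S, <<s \bigcup_k C k >> S -> P (X1 @^-1` S) = P (X2 @^-1` S).
Proof.
move=> mX1 mX2 i1 i2 X12 S sS.
pose Y1 : {mfun T >-> E'} := HB.pack (X1 : T -> E')
  (isMeasurableFun.Build _ _ _ _ _ (measurable_configuration mX1)).
pose Y2 : {mfun T >-> E'} := HB.pack (X2 : T -> E')
  (isMeasurableFun.Build _ _ _ _ _ (measurable_configuration mX2)).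
apply: (@measure_unique_cylinders _ E' R Key C CT CI _
  (pushforward P Y1) (pushforward P Y2)) => //.
- by move=> k B kB; apply: sub_sigma_algebra; exists k.
- by rewrite /= /pushforward preimage_setT probability_setT ltry.
move=> J B uJ hB; rewrite /= /pushforward /= !preimage_bigcap.
have im X k : k \in J -> preimage_set_system setT X (C k) (X @^-1` B k).
  by move=> kJ; exists (B k); [exact: hB|rewrite setTI].
rewrite i1//; last by move=> k; exact: im.
rewrite i2//; last by move=> k; exact: im.
by apply: eq_big_seq => k /hB; exact: X12.
Qed.

End law_transfer.

Section blocks.
Context {R : realType} {d : measure_display} {T : measurableType d}.
Variable P : probability T R.
Variables (Key : eqType) (E : Key -> set T) (x : R).
Hypothesis mE : forall k, measurable (E k).
Hypothesis indep : forall J : seq Key, uniq J ->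
  P (\bigcap_(k in [set` J]) E k) = (\prod_(k <- J) P (E k))%E.
Hypothesis PE : forall k, P (E k) = x%:E.

Let all_of (J : seq Key) := \bigcap_(k in [set` J]) E k.

Let measurable_all_of J : measurable (all_of J).
Proof. by apply: fin_bigcap_measurable => //; exact: finite_seq. Qed.

Definition no_block (Js : seq (seq Key)) :=
  \bigcap_(J in [set` Js]) ~` \bigcap_(k in [set` J]) E k.

Lemma measurable_no_block Js : measurable (no_block Js).
Proof.
apply: fin_bigcap_measurable => [|J _]; first exact: finite_seq.
exact/measurableC/measurable_all_of.
Qed.

(** The induction carries a list [K] of events that are required to hold: to avoid
one more block, remove the case where the whole block holds in addition to [K],
which is again of this form. *)
Lemma probability_no_block m (Js : seq (seq Key)) : uniq (flatten Js) ->
  all (fun J => size J == m) Js ->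
  P (no_block Js) = ((1 - x ^+ m) ^+ size Js)%:E.
Proof.
move=> uJs sJs.
suff h K : uniq (K ++ flatten Js) ->
    P (all_of K `&` no_block Js) = (x ^+ size K * (1 - x ^+ m) ^+ size Js)%:E.
  have := h [::] uJs; rewrite /= mul1r => <-; congr (P _).
  by rewrite /all_of; apply/seteqP; split => [w hw|w []//]; split.
elim: Js sJs {uJs} K => [|J Js IHJs] /= => [_ K|/andP[/eqP sJ sJs] K uK].
  rewrite cats0 mulr1 => uK.
  have -> : all_of K `&` no_block [::] = all_of K.
    by apply/seteqP; split => [w []//|w hw]; split.
  rewrite /all_of indep// (eq_bigr (fun=> x%:E))//.
  by elim: K {uK} => [|k K IHK]; rewrite ?big_nil// big_cons IHK -EFinM exprS.
have uK1 : uniq (K ++ flatten Js).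
  by move: uK; rewrite /= uniq_catCA cat_uniq => /and3P[].
have uK2 : uniq ((K ++ J) ++ flatten Js) by rewrite -catA.
set A := all_of K `&` no_block Js; set B := all_of (K ++ J) `&` no_block Js.
have BA : B `<=` A.
  by move=> w [hw nw]; split=> // k kK; apply: hw; rewrite /= mem_cat [k \in K]kK.
have -> : all_of K `&` no_block (J :: Js) = A `\` B.
  apply/seteqP; split => w.
    move=> [hK hn]; split; first by split=> // J' J'Js; apply: hn; rewrite /= inE J'Js orbT.
    move=> [hKJ _]; apply: (hn J); first by rewrite /= mem_head.
    by move=> k kJ; apply: hKJ; rewrite /= mem_cat [k \in J]kJ orbT.
  move=> [[hK hn] nB]; split=> // J'; rewrite /= inE => /predU1P[->|J'Js]; last exact: hn.
  move=> hJ; apply: nB; split=> // k; rewrite /= mem_cat => /orP[]; first exact: hK.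
  exact: hJ.
have mA : measurable A by exact/measurableI/measurable_no_block/measurable_all_of.
have mB : measurable B by exact/measurableI/measurable_no_block/measurable_all_of.
rewrite measureD//; last by rewrite (le_lt_trans (probability_le1 P mA))// ltry.
have hA : P A = (x ^+ size K * (1 - x ^+ m) ^+ size Js)%:E by exact: IHJs.
have hB : P B = (x ^+ size (K ++ J) * (1 - x ^+ m) ^+ size Js)%:E by exact: IHJs.
rewrite [A `&` B]setIidr//; transitivity (P A - P B)%E => //.
rewrite hA hB -EFinB size_cat sJ exprD exprS.
by congr EFin; ring.
Qed.

End blocks.

Section ties.
Context {R : realType} {d : measure_display} {T : measurableType d}.
Variable P : probability T R.

Lemma measurable_tie (X Z : {RV P >-> R}) :
  measurable [set w | 0 <= X w /\ X w = Z w].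
Proof.
rewrite (_ : [set w | _] = [set w | 0 <= X w] `&` [set w | X w - Z w = 0]).
  apply: measurableI.
    rewrite (_ : [set w | _] = X @^-1` `[0, +oo[%classic); first exact: measurable_funPTI.
    by apply/seteqP; split => w /=; rewrite in_itv /= andbT.
  have mD : measurable_fun setT (fun w => X w - Z w) by exact: measurable_funB.
  by rewrite -[X in measurable X]setTI; exact: (mD measurableT [set 0] (measurable_set1 0)).
by apply/seteqP; split => w [/= h /eqP e]; split=> //; apply/eqP;
  rewrite ?subr_eq0 // -subr_eq0.
Qed.

(** A variable with bounded density meets an independent one with probability
zero: in each cell of a fine grid, the former has small probability. *)
Lemma probability_tie (X Z : {RV P >-> R}) (lam : R) : 0 <= lam ->
  (forall a h : R, 0 <= h ->
    (P (X @^-1` `[a, (a + h)%R[%classic) <= (lam * h)%:E)%E) ->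
  (forall B, measurable B ->
    P (X @^-1` B `&` Z @^-1` B) = (P (X @^-1` B) * P (Z @^-1` B))%E) ->
  P [set w | 0 <= X w /\ X w = Z w] = 0%E.
Proof.
move=> lam0 hX indep; apply/eqP; rewrite eq_le measure_ge0 andbT.
have mXZ := measurable_tie X Z.
apply/lee_addgt0Pr => e e0; rewrite add0e.
pose h := e / (lam + 1).
have h0 : 0 < h by rewrite divr_gt0// ltr_wpDl.
have lamh : lam * h <= e.
  rewrite /h mulrCA -[leRHS]mulr1 ler_wpM2l ?(ltW e0)// ler_pdivrMr ?ltr_wpDl//.
  by rewrite mul1r lerDl.
pose I k := `[k%:R * h, k%:R * h + h[%classic : set R.
have mI k : measurable (I k) by exact: measurable_itv.
have disj : trivIset setT (fun k => Z @^-1` I k).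
  apply/trivIsetP => j k _ _ jk; apply/seteqP; split=> // w [].
  rewrite /I /= !in_itv /= => /andP[a1 a2] /andP[b1 b2]; case/eqP: jk.
  have h1 : (j%:R < k.+1%:R :> R).
    by rewrite -(ltr_pM2r h0) -natr1 mulrDl mul1r; exact: le_lt_trans b2.
  have h2 : (k%:R < j.+1%:R :> R).
    by rewrite -(ltr_pM2r h0) -natr1 mulrDl mul1r; exact: le_lt_trans a2.
  by move: h1 h2; rewrite !ltr_nat; lia.
have mZ k : measurable (Z @^-1` I k).
  exact: measurable_funPTI.
have mX k : measurable (X @^-1` I k).
  exact: measurable_funPTI.
apply: (@le_trans _ _ (\sum_(k <oo) P (X @^-1` I k `&` Z @^-1` I k))%E).
  apply: (@measure_sigma_subadditive _ _ _ P _ (fun k => X @^-1` I k `&` Z @^-1` I k)) => //.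
    by move=> k; exact: measurableI.
  move=> w [X0 XZ]; have Xh0 : 0 <= X w / h by rewrite divr_ge0// ltW.
  have /andP[l1 l2] := truncn_itv Xh0.
  exists (Num.truncn (X w / h)) => //; rewrite /I /= -XZ.
  suff : X w \in `[(Num.truncn (X w / h))%:R * h, (Num.truncn (X w / h))%:R * h + h[ by [].
  rewrite in_itv /= -ler_pdivlMr// l1 /=.
  by move: l2; rewrite ltr_pdivrMr// -natr1 mulrDl mul1r.
apply: (@le_trans _ _ (\sum_(k <oo) ((lam * h)%:E * P (Z @^-1` I k)))%E).
  apply: lee_nneseries => // k _; rewrite indep//.
  by rewrite lee_wpmul2r// hX// ltW.
rewrite nneseriesZl//.
have -> : (\sum_(k <oo) P (Z @^-1` I k) = P (\bigcup_k (Z @^-1` I k)))%E.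
  by rewrite measure_bigcup//; apply: eq_eseriesl => k; rewrite in_setT.
apply: (@le_trans _ _ ((lam * h)%:E * 1)%E); last by rewrite mule1 lee_fin.
apply: lee_wpmul2l; first by rewrite lee_fin mulr_ge0// ltW.
by apply: probability_le1; apply: bigcup_measurable => k _.
Qed.

End ties.

(** * Poisson requests on one circle *)

Section almost_everywhere_countable.
Context {R : realType} {d : measure_display} {T : measurableType d}.
Variable mu : {measure set T -> \bar R}.

Lemma ae_null (A : set T) : measurable A -> mu A = 0%E ->
  {ae mu, forall w, ~ A w}.
Proof. by move=> mA A0; exists A; split => // w /= /contrapT. Qed.

Lemma ae_countable (I : countType) (A : I -> T -> Prop) :
  (forall i, {ae mu, forall w, A i w}) -> {ae mu, forall w, forall i, A i w}.
Proof.
move=> h; have : mu.-negligible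
    (\bigcup_k (if (choice.unpickle k : option I) is Some i
      then [set w | ~ A i w] else set0)).
  apply: negligible_bigcup => k; case: choice.unpickle => [i|]; last exact: negligible_set0.
  exact: (h i).
apply: negligibleS => w /= /existsNP[i nA]; exists (choice.pickle i) => //.
by rewrite choice.pickleK.
Qed.

End almost_everywhere_countable.

Section exponential_law.
Context {R : realType} (lam : R).
Hypothesis lam0 : 0 < lam.

Lemma exponential_prob_lt0 : exponential_prob lam `]-oo, 0[%classic = 0%E.
Proof.
rewrite /exponential_prob integral0_eq// => x; rewrite /= in_itv /= => x0.
by rewrite lt0_exponential_pdf.
Qed.

Lemma exponential_pdf_le x : exponential_pdf lam x <= lam.
Proof.
have [x0|x0] := ltP x 0; first by rewrite lt0_exponential_pdf// ltW.
rewrite exponential_pdfE//.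
suff : lam * expR (- lam * x) <= lam * 1 by rewrite mulr1.
apply: ler_wpM2l; first exact: ltW.
by rewrite -[leRHS]expR0 ler_expR mulNr oppr_le0 mulr_ge0// ltW.
Qed.

Lemma exponential_prob_itv_le (a h : R) : 0 <= h ->
  (exponential_prob lam `[a, (a + h)%R[%classic <= (lam * h)%:E)%E.
Proof.
move=> h0; rewrite /exponential_prob.
apply: (@le_trans _ _ (\int[lebesgue_measure]_(x in `[a, (a + h)%R[) (lam%:E))%E).
  apply: ge0_le_integral => //.
  - by move=> x _; rewrite lee_fin exponential_pdf_ge0// ltW.
  - apply/measurable_EFinP; apply: measurable_funTS; exact: measurable_exponential_pdf.
  - by move=> x _; rewrite lee_fin exponential_pdf_le.
rewrite integral_cst//= lebesgue_measure_itv/= lte_fin.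
case: ifPn => _; first by rewrite -EFinB -EFinM [a + h]addrC addrK.
by rewrite mule0 lee_fin mulr_ge0// ltW.
Qed.

End exponential_law.

Section one_circle.
Context {R : realType} {d : measure_display} {T : measurableType d}.
Variable P : probability T R.
Variables (m : nat) (F : probability nat R).
Hypothesis hF : F [set k | (1 <= k <= m)%N] = 1%E.
Variables (lam : R) (n : nat) (q : requests P n).
Hypothesis lam0 : 0 < lam.
Hypothesis hq : marked_poisson F lam q.
Variable t : R.
Hypothesis t0 : 0 < t.

Let gapP i j B : measurable B -> P (gap q i j @^-1` B) = exponential_prob lam B.
Proof. by case: hq => h _ _ mB; rewrite -(h i j). Qed.

Let indep : mutually_independent P (request_events q).
Proof. by case: hq. Qed.

Let ev_gap i j B : measurable B ->
  request_events q (inl (i, j)) (gap q i j @^-1` B).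
Proof. by move=> mB; exists B => //; rewrite setTI. Qed.

Lemma request_eventsT k : request_events q k setT.
Proof. by case: k => ij; exists setT; rewrite ?setTI ?preimage_setT. Qed.

Lemma request_eventsI k : setI_closed (request_events q k).
Proof.
by case: k => ij _ _ [B mB <-] [B' mB' <-]; exists (B `&` B');
  rewrite ?setTI ?preimage_setI//; exact: measurableI.
Qed.

Lemma request_events_measurable k : request_events q k `<=` measurable.
Proof. by case: k => ij _ [B mB <-]; rewrite setTI; exact: measurable_funPTI. Qed.

Lemma measurable_arrival i j : measurable_fun setT (fun w => arrival q w i j).
Proof. by rewrite /arrival; apply: measurable_sum => l. Qed.

Lemma gap_lt0 i j : P (gap q i j @^-1` `]-oo, 0[) = 0%E.
Proof. by rewrite gapP// exponential_prob_lt0. Qed.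

Lemma gap_itv_le i j (a h : R) : 0 <= h ->
  (P (gap q i j @^-1` `[a, (a + h)%R[%classic) <= (lam * h)%:E)%E.
Proof. by move=> h0; rewrite gapP//; exact: exponential_prob_itv_le. Qed.

Lemma gap_le i j : P (gap q i j @^-1` `]-oo, t]) = (1 - expR (- lam * t))%:E.
Proof.
have -> : `]-oo, t]%classic = `]-oo, 0[%classic `|` `[0, t]%classic :> set R.
  apply/seteqP; split => x /=; rewrite !in_itv /=.
    by move=> xt; have [x0|x0] := ltP x 0; [left|right; rewrite xt].
  by case=> [x0|/andP[]//]; exact: le_trans (ltW x0) (ltW t0).
rewrite preimage_setU measureU; first last.
- apply/seteqP; split => // w [] /=; rewrite !in_itv /= => h1 /andP[h2 _].
  by move: h1; rewrite ltNge h2.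
- exact: measurable_funPTI.
- exact: measurable_funPTI.
rewrite -[X in (X + _)%E]/(P _) gap_lt0 add0e.
by rewrite -[LHS]/(P _) gapP// exponential_prob_itv0c.
Qed.

Lemma gap_gt i j : P (gap q i j @^-1` `]t, +oo[) = (expR (- lam * t))%:E.
Proof.
have -> : gap q i j @^-1` `]t, +oo[ = ~` (gap q i j @^-1` `]-oo, t]).
  by rewrite preimage_setC setCitvl.
rewrite probability_setC; last exact: measurable_funPTI.
by rewrite gap_le -EFinB; congr EFin; ring.
Qed.

Lemma gaps_gt0 : {ae P, forall w, forall ij : 'I_n * nat, 0 < gap q ij.1 ij.2 w}.
Proof.
apply: ae_countable => -[i j] /=.
have h0 : P (gap q i j @^-1` [set 0]) = 0%E.
  apply/eqP; rewrite eq_le measure_ge0 andbT; apply/lee_addgt0Pr => e e0.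
  have h0 : 0 <= e / lam by rewrite divr_ge0// ltW.
  apply: (@le_trans _ _ (P (gap q i j @^-1` `[0, (0 + e / lam)%R[%classic))).
    apply: le_measure; rewrite ?inE; try exact: measurable_funPTI.
    by move=> w /= ->; rewrite in_itv /= lexx add0r divr_gt0.
  apply: le_trans (gap_itv_le i j 0 h0) _.
  by rewrite add0e lee_fin mulrCA mulfV ?gt_eqF// mulr1.
have a1 := ae_null (measurable_funPTI (gap q i j) (measurable_itv `]-oo, 0[)) (gap_lt0 i j).
have a2 := ae_null (measurable_funPTI (gap q i j) (measurable_set1 0)) h0.
apply: filterS2 a1 a2 => w /= n1 n2; rewrite lt_neqAle; apply/andP; split.
  by apply/eqP => e; apply: n2.
by rewrite leNgt; apply/negP => g0; apply: n1; rewrite in_itv.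
Qed.

Lemma marks_range : {ae P, forall w, forall ij : 'I_n * nat,
  (1 <= mark q ij.1 ij.2 w <= m)%N}.
Proof.
apply: ae_countable => -[i j] /=.
pose B := ~` [set k | (1 <= k <= m)%N] : set nat.
have PB : P (mark q i j @^-1` B) = 0%E.
  transitivity (F B); first by case: hq => _ h _; rewrite -(h i j).
  by rewrite /B probability_setC// hF subee.
have := ae_null (measurable_funPTI (mark q i j) (_ : measurable B)) PB; move=> /(_ Logic.I).
by apply: filterS => w /= h; exact: contrapT.
Qed.

(** Arbitrarily many requests before time [t] would need arbitrarily many short
gaps. *)
Lemma long_gap i : {ae P, forall w, exists l, t < gap q i l w}.
Proof.
pose x := 1 - expR (- lam * t).
have x1 : `|x| < 1.
  have := expR_gt0 (- lam * t).
  have : expR (- lam * t) <= 1.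
    by rewrite -[leRHS]expR0 ler_expR mulNr oppr_le0 mulr_ge0// ltW.
  by rewrite /x ltr_norml => h1 h2; apply/andP; split; lra.
pose A := \bigcap_l (gap q i l @^-1` `]-oo, t]).
have mA : measurable A.
  by apply: bigcapT_measurable => l; exact: measurable_funPTI.
have PA : P A = 0%E.
  apply/eqP; rewrite eq_le measure_ge0 andbT; apply/lee_addgt0Pr => e e0; rewrite add0e.
  have := cvg_expr x1; move=> /cvgrPdist_lt /(_ _ e0) [k _ /(_ k (leqnn k))].
  rewrite sub0r normrN => xk.
  pose J : seq (('I_n * nat) + ('I_n * nat)) := [seq inl (i, l) | l <- iota 0 k].
  pose E (key : ('I_n * nat) + ('I_n * nat)) :=
    if key is inl ij then gap q ij.1 ij.2 @^-1` `]-oo, t] else setT.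
  have uJ : uniq J by rewrite map_inj_uniq ?iota_uniq// => l l' [].
  have PE : P (\bigcap_(key in [set` J]) E key) = (x ^+ k)%:E.
    rewrite indep// => [|_ /mapP[l _ ->]]; last exact: ev_gap.
    rewrite big_map (eq_bigr (fun=> x%:E)) => [|l _]; last exact: gap_le.
    rewrite -[in RHS](size_iota 0 k); elim: (iota 0 k) => [|l s IHs].
      by rewrite big_nil.
    by rewrite big_cons IHs -EFinM exprS.
  apply: (@le_trans _ _ (P (\bigcap_(key in [set` J]) E key))); last first.
    by rewrite PE lee_fin; apply: le_trans (ltW xk); exact: ler_norm.
  apply: le_measure; rewrite ?inE//.
    apply: fin_bigcap_measurable; first exact: finite_seq.
    by move=> _ /= /mapP[l _ ->]; exact: measurable_funPTI.
  by move=> w hw _ /= /mapP[l _ ->]; exact: hw.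
apply: filterS (ae_null mA PA) => w nA; apply: contrapT => h; apply: nA => l _ /=.
by rewrite in_itv /= leNgt; apply/negP => tg; apply: h; exists l.
Qed.

Lemma arrivalS w i j :
  arrival q w i j.+1 = arrival q w i j + gap q i j.+1 w.
Proof. by rewrite /arrival big_ord_recr. Qed.

Lemma arrival_lt w i j k : (forall ij : 'I_n * nat, 0 < gap q ij.1 ij.2 w) ->
  (j < k)%N -> arrival q w i j < arrival q w i k.
Proof.
move=> g0; elim: k => // k IHk; rewrite ltnS leq_eqVlt => /predU1P[->|jk].
  by rewrite arrivalS ltrDl (g0 (i, k.+1)).
by rewrite arrivalS (lt_trans (IHk jk))// ltrDl (g0 (i, k.+1)).
Qed.

Lemma arrival_ge_gap w i j : (forall ij : 'I_n * nat, 0 < gap q ij.1 ij.2 w) ->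
  gap q i j w <= arrival q w i j.
Proof.
move=> g0; rewrite /arrival big_ord_recr /= lerDr sumr_ge0// => l _.
exact/ltW/(g0 (i, val l)).
Qed.

(** The first gap at location [i] is independent of all other gaps, and a tie
prescribes its value in terms of them. *)
Lemma no_ties : {ae P, forall w, forall x : ('I_n * nat) * ('I_n * nat),
  x.1.1 != x.2.1 -> arrival q w x.1.1 x.1.2 != arrival q w x.2.1 x.2.2}.
Proof.
apply: ae_countable => -[[i j] [i' j']] /=.
have [->|ii'] := eqVneq i i'; first exact: aeW.
pose i0 : ('I_n * nat) + ('I_n * nat) := inl (i, 0%N).
pose Z w := arrival q w i' j' - \sum_(l < j) gap q i l.+1 w.
pose G := \bigcup_(k in [set k | k != i0]) request_events q k.
pose T' : measurableType _ := g_sigma_algebraType G.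
have mgap k l : (k, l) != (i, 0%N) -> measurable_fun setT (gap q k l : T' -> R).
  move=> kl _ B mB; rewrite setTI; apply: sub_sigma_algebra.
  by exists (inl (k, l)) => /=; [rewrite /i0; apply: contra_neq kl => -[-> ->]|exact: ev_gap].
have mZ' : measurable_fun setT (Z : T' -> R).
  apply: measurable_funB.
    apply: measurable_sum => l; apply: mgap.
    by apply: contra_neq ii' => -[].
  by apply: measurable_sum => l; apply: mgap; apply/eqP => -[].
have mZ : measurable_fun setT (Z : T -> R).
  apply: measurable_funB; first exact: measurable_arrival.
  by apply: measurable_sum => l.
pose Z0 : {RV P >-> R} := HB.pack (Z : T -> R) (isMeasurableFun.Build _ _ _ _ _ mZ).
have h := @probability_tie _ _ _ P (gap q i 0) Z0 lam (ltW lam0) (gap_itv_le i 0).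
have mE := measurable_tie (gap q i 0) Z0.
have PE : P [set w | 0 <= gap q i 0 w /\ gap q i 0 w = Z w] = 0%E.
  apply: h => B mB; apply: (@independent_of_others _ _ _ P _ (request_events q) i0).
  - exact: request_eventsT.
  - exact: request_eventsI.
  - exact: request_events_measurable.
  - exact: indep.
  - exact: ev_gap.
  - by have := mZ' measurableT B mB; rewrite setTI.
apply: filterS2 (ae_null mE PE) gaps_gt0 => w nE g0 _.
apply/eqP => e; apply: nE; split; first exact/ltW/(g0 (i, 0%N)).
change (gap q i 0%N w = Z w).
by rewrite /Z -e /arrival big_ord_recl /= addrK.
Qed.

(** These properties hold almost surely, and make the chronology unambiguous. *)
Definition regular w := [/\ finite_set (points (arrival q w) t),
  forall x x' : 'I_n * nat, arrival q w x.1 x.2 = arrival q w x'.1 x'.2 -> x = x',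
  forall i j, (1 <= mark q i j w <= m)%N &
  forall i j, gap q i 0 w <= arrival q w i j].

Lemma regular_ae : {ae P, forall w, regular w}.
Proof.
have hlong : {ae P, forall w, forall i : 'I_n, exists l, t < gap q i l w}.
  by apply: ae_countable => i; exact: long_gap.
have : {ae P, forall w, (forall ij : 'I_n * nat, 0 < gap q ij.1 ij.2 w) /\
    (forall i : 'I_n, exists l, t < gap q i l w)}.
  by apply: filterS2 gaps_gt0 hlong.
apply: filterS3 no_ties marks_range => w nt mr [g0 lg]; split.
- have hl i := cid (lg i).
  apply: (@sub_finite_set _ _ ([set: 'I_n] `*` `I_(\max_i (projT1 (hl i))))); last first.
    by apply: finite_setX.
  move=> [i j] /= ijt; split=> //.
  apply: (@leq_trans (projT1 (hl i))); last exact: leq_bigmax.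
  rewrite ltnNge; apply/negP => lj.
  have : t < arrival q w i j.
    apply: lt_le_trans (projT2 (hl i)) _.
    apply: le_trans (arrival_ge_gap i _ g0) _.
    by move: lj; rewrite leq_eqVlt => /predU1P[->//|/(arrival_lt i g0)/ltW].
  by rewrite ltNge ijt.
- move=> [i j] [i' j'] /= e.
  have [ii'|ii'] := eqVneq i i'; last first.
    by have := nt ((i, j), (i', j')) ii'; rewrite e eqxx.
  rewrite ii' in e *; have [jj'|jj'|->//] := ltngtP j j'.
    by have := arrival_lt i' g0 jj'; rewrite e ltxx.
  by have := arrival_lt i' g0 jj'; rewrite e ltxx.
- by move=> i j; exact: mr (i, j).
- move=> i [|j]; first exact: arrival_ge_gap.
  apply: le_trans (arrival_ge_gap i 0%N g0) _.
  by apply/ltW/arrival_lt.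
Qed.

End one_circle.

(** * Comparison of circles of different sizes *)

Section probability_difference.
Context {R : realType} {d : measure_display} {T : measurableType d}.
Variable P : probability T R.

Lemma probability_close (U V D : set T) : measurable U -> measurable V ->
  measurable D -> (forall w, ~ D w -> U w <-> V w) ->
  `|fine (P U) - fine (P V)| <= fine (P D).
Proof.
move=> mU mV mD UV.
have le A B : measurable A -> measurable B -> A `<=` B `|` D ->
    fine (P A) <= fine (P B) + fine (P D).
  move=> mA mB AB; rewrite -lee_fin EFinD !fineK ?fin_num_measure//.
  apply: (@le_trans _ _ (P (B `|` D))); last exact: measureU2.
  by apply: le_measure; rewrite ?inE//; exact: measurableU.
rewrite ler_distl; apply/andP; split.
  rewrite lerBlDr; apply: le => // w Vw.
  by have [Dw|nD] := pselect (D w); [right|left; apply/UV].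
apply: le => // w Uw.
by have [Dw|nD] := pselect (D w); [right|left; apply/UV].
Qed.

End probability_difference.

Section window.
Context {R : realType} {d : measure_display} {T : measurableType d}.
Variable P : probability T R.
Variables (m : nat) (F : probability nat R).
Hypothesis m0 : (0 < m)%N.
Hypothesis hF : F [set k | (1 <= k <= m)%N] = 1%E.
Variables (lam t : R) (q : forall n, requests P n).
Hypothesis lam0 : 0 < lam.
Hypothesis t0 : 0 < t.
Hypothesis hq : forall n, marked_poisson F lam (q n).

Let x := expR (- lam * t).

Lemma request_sigma_remaining n c :
  request_sigma (q n) [set w | c \in remaining (q n) t w].
Proof.
pose T' : measurableType _ := g_sigma_algebraType (\bigcup_k request_events (q n) k).
have mgap i j : measurable_fun setT (gap (q n) i j : T' -> R).
  move=> _ B mB; rewrite setTI; apply: sub_sigma_algebra.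
  by exists (inl (i, j)) => //; exists B; rewrite ?setTI.
have marr i j : measurable_fun setT ((fun w => arrival (q n) w i j) : T' -> R).
  by apply: measurable_sum => l; exact: mgap.
have mmark i j : measurable_fibers (mark (q n) i j : T' -> nat).
  move=> v; apply: sub_sigma_algebra.
  by exists (inr (i, j)) => //; exists [set v]; rewrite ?setTI.
exact: (@measurable_mem_available _ T' R n
  (fun i j w => arrival (q n) w i j) (fun i j w => mark (q n) i j w) marr mmark t c).
Qed.

Lemma request_sigma_measurable n : request_sigma (q n) `<=` measurable.
Proof.
apply: (smallest_sub (@sigma_algebra_measurable _ T)).
by move=> A [k _]; exact: request_events_measurable.
Qed.

Lemma measurable_remaining n c : measurable [set w | c \in remaining (q n) t w].
Proof. exact: (request_sigma_measurable (request_sigma_remaining c)). Qed.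

Lemma measurable_picked n c : measurable [set w | c \notin remaining (q n) t w].
Proof.
rewrite (_ : [set w | _] = ~` [set w | c \in remaining (q n) t w]).
  exact/measurableC/measurable_remaining.
by apply/seteqP; split => w /= /negP.
Qed.

Definition picked n c := fine (P [set w | c \notin remaining (q n) t w]).

Section blocks_of_locations.
Variables (n a : nat) (n0 : (0 < n)%N).

Definition location_blocks B s :=
  [seq [seq unroll a n0 u | u <- iota (s + b * m) m] | b <- iota 0 B].

Let quiet (i : 'I_n) := gap (q n) i 0 @^-1` `]t, +oo[.

Let unroll_inj u v : (u < n)%N -> (v < n)%N ->
  unroll a n0 u = unroll a n0 v -> u = v.
Proof. by move=> un vn /(congr1 (coord a)); rewrite !unrollK. Qed.

Lemma flatten_location_blocks B s :
  flatten (location_blocks B s) = [seq unroll a n0 u | u <- iota s (B * m)].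
Proof.
elim: B => [|B IHB]; first by [].
rewrite /location_blocks -addn1 iotaD map_cat flatten_cat -/(location_blocks B s).
by rewrite IHB /= cats0 add0n mulnDl mul1n iotaD map_cat.
Qed.

Lemma probability_no_quiet_block B s : (s + B * m <= n)%N ->
  P (no_block quiet (location_blocks B s)) = ((1 - x ^+ m) ^+ B)%:E.
Proof.
move=> sB; rewrite (@probability_no_block _ _ _ P _ quiet x _ _ _ m).
- by rewrite size_map size_iota.
- by move=> i; exact: measurable_funPTI.
- move=> J uJ; have := hq n; case=> _ _ indep.
  pose J' : seq (('I_n * nat) + ('I_n * nat)) := [seq inl (i, 0%N) | i <- J].
  pose E (key : ('I_n * nat) + ('I_n * nat)) :=
    if key is inl ij then quiet ij.1 else setT.
  have -> : \bigcap_(i in [set` J]) quiet i = \bigcap_(k in [set` J']) E k.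
    apply/seteqP; split => w hw; first by move=> _ /= /mapP[i iJ ->]; exact: hw.
    move=> i iJ; have : E (inl (i, 0%N)) w by apply: hw; apply/mapP; exists i.
    exact.
  rewrite indep ?big_map//; first by rewrite map_inj_uniq// => i i' [].
  move=> _ /mapP[i _ ->]; exists `]t, +oo[%classic; last by rewrite setTI.
  exact: measurable_itv.
- by move=> i; exact: (gap_gt (hq n) t0).
- rewrite flatten_location_blocks map_inj_in_uniq ?iota_uniq// => u v.
  by rewrite !mem_iota => hu hv; apply: unroll_inj; lia.
- by apply/allP => _ /mapP[b _ ->]; rewrite size_map size_iota.
Qed.

Lemma measurable_no_quiet_block B s :
  measurable (no_block quiet (location_blocks B s)).
Proof. by apply: measurable_no_block => i; exact: measurable_funPTI. Qed.

Lemma quiet_block_exists B s w : ~ no_block quiet (location_blocks B s) w ->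
  exists2 b, (b < B)%N &
    forall u, (s + b * m <= u < s + b * m + m)%N -> t < gap (q n) (unroll a n0 u) 0 w.
Proof.
move=> /existsNP[J /not_implyP[/mapP[b]]].
rewrite mem_iota => bB -> /contrapT h; exists b => // u hu.
have : unroll a n0 u \in [seq unroll a n0 u | u <- iota (s + b * m) m].
  by rewrite map_f// mem_iota.
by move=> /h; rewrite /quiet /= in_itv /= andbT.
Qed.

End blocks_of_locations.

End window.

Section comparison.
Context {R : realType} {d : measure_display} {T : measurableType d}.
Variable P : probability T R.
Variables (m : nat) (F : probability nat R).
Hypothesis m0 : (0 < m)%N.
Hypothesis hF : F [set k | (1 <= k <= m)%N] = 1%E.
Variables (lam t : R) (q : forall n, requests P n).
Hypothesis lam0 : 0 < lam.
Hypothesis t0 : 0 < t.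
Hypothesis hq : forall n, marked_poisson F lam (q n).

Let x := expR (- lam * t).

Section configurations.
Variables (N n a : nat) (n0 : (0 < n)%N).
Hypothesis Nn : (N <= n)%N.

Let key : Type := (('I_N * nat) + ('I_N * nat))%type.
Let config : Type := ((('I_N * nat) -> R) * (('I_N * nat) -> nat))%type.

Let coordinate (k : key) : set_system config :=
  match k with
  | inl ij => preimage_set_system setT (fun c : config => c.1 ij) measurable
  | inr ij => preimage_set_system setT (fun c : config => c.2 ij) measurable
  end.

Let gaps_to_arrival (c : config) (i : 'I_N) j := \sum_(l < j.+1) c.1 (i, val l).

Let all_config (w : T) : config :=
  (fun ij => gap (q N) ij.1 ij.2 w, fun ij => mark (q N) ij.1 ij.2 w).

Let window (w : T) : config :=
  (fun ij : 'I_N * nat => gap (q n) (unroll a n0 ij.1) ij.2 w,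
   fun ij : 'I_N * nat => mark (q n) (unroll a n0 ij.1) ij.2 w).

Let place (k : key) : (('I_n * nat) + ('I_n * nat))%type :=
  match k with
  | inl ij => inl (unroll a n0 ij.1, ij.2)
  | inr ij => inr (unroll a n0 ij.1, ij.2)
  end.

Lemma unroll_inj (i i' : 'I_N) : unroll a n0 i = unroll a n0 i' -> i = i'.
Proof.
move=> /(congr1 (coord a)); rewrite !unrollK ?(leq_trans _ Nn)//.
exact: val_inj.
Qed.

Let place_inj : injective place.
Proof.
move=> [[i j]|[i j]] [[i' j']|[i' j']] //= -[e ->];
  by rewrite (_ : i = i')//; apply: unroll_inj; exact: val_inj.
Qed.

Definition window_remaining (w : T) : {set 'I_N} :=
  available (fun i j => arrival (q n) w (unroll a n0 i) j)
    (fun i j => mark (q n) (unroll a n0 i) j w) t.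

(** Read in a window, the requests on a large circle have the law of those on the
small circle [N]. *)
Lemma window_law c :
  measurable [set w | c \notin window_remaining w] /\
  fine (P [set w | c \notin window_remaining w]) = picked t q c.
Proof.
pose E' : measurableType _ := g_sigma_algebraType (\bigcup_k coordinate k).
pose S : set config := [set e | c \notin
  available (gaps_to_arrival e) (fun i j => e.2 (i, j)) t].
have mS : <<s \bigcup_k coordinate k >> S.
  have mgap i j : measurable_fun setT ((fun e : config => gaps_to_arrival e i j) : E' -> R).
    apply: measurable_sum => l _ B mB; rewrite setTI; apply: sub_sigma_algebra.
    by exists (inl (i, val l)) => //; exists B; rewrite ?setTI.
  have mmark i j : measurable_fibers ((fun e : config => e.2 (i, j)) : E' -> nat).
    move=> v; apply: sub_sigma_algebra.
    by exists (inr (i, j)) => //; exists [set v]; rewrite ?setTI.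
  have := @measurable_mem_available _ E' R N
    (fun i j e => gaps_to_arrival e i j) (fun i j e => e.2 (i, j)) mgap mmark t c.
  move=> /measurableC; congr (measurable _).
  by apply/seteqP; split => e /= /negP.
have mX1 k B : coordinate k B -> measurable (window @^-1` B).
  case: k => [[i j]|[i j]] [C mC <-]; rewrite setTI.
    exact: (measurable_funPTI (gap (q n) (unroll a n0 i) j) mC).
  exact: (measurable_funPTI (mark (q n) (unroll a n0 i) j) mC).
have mX2 k B : coordinate k B -> measurable (all_config @^-1` B).
  case: k => [[i j]|[i j]] [C mC <-]; rewrite setTI.
    exact: (measurable_funPTI (gap (q N) i j) mC).
  exact: (measurable_funPTI (mark (q N) i j) mC).
have CT k : coordinate k setT.
  by case: k => ij; exists setT => //; rewrite setTI preimage_setT.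
have CI k : setI_closed (coordinate k).
  by case: k => ij _ _ [B mB <-] [B' mB' <-]; exists (B `&` B');
    rewrite ?setTI ?preimage_setI//; exact: measurableI.
have mS1 := measurable_configuration mX1 measurableT mS; rewrite setTI in mS1.
split; first exact: mS1.
congr fine; apply: (@law_transfer R d T P config (('I_N * nat) + ('I_N * nat))%type
  coordinate CT CI window all_config mX1 mX2 _ _ _ S mS).
- case: (hq n) => _ _ indep.
  apply: mutually_independent_sub (mutually_independent_inj place_inj indep).
  move=> [[i j]|[i j]] _ [_ [B mB <-] <-]; exists B => //=;
  by rewrite !setTI.
- case: (hq N) => _ _; apply: mutually_independent_sub.
  move=> [[i j]|[i j]] _ [_ [B mB <-] <-]; exists B => //=;
  by rewrite !setTI.
move=> [[i j]|[i j]] _ [B mB <-]; rewrite setTI.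
  case: (hq n) => h _ _; case: (hq N) => h' _ _.
  by rewrite -[LHS]/(distribution P (gap (q n) (unroll a n0 i) j) B)
    -[RHS]/(distribution P (gap (q N) i j) B) h// h'.
case: (hq n) => _ h _; case: (hq N) => _ h' _.
by rewrite -[LHS]/(distribution P (mark (q n) (unroll a n0 i) j) B)
  -[RHS]/(distribution P (mark (q N) i j) B) h// h'.
Qed.

End configurations.
Let center B : 'I_(2 * (B * m)).+1 := unroll 0 (ltn0Sn _) (B * m).

(** Between two arcs of [m] locations without requests, the packages evolve
independently of the rest of the circle; such arcs are found on both sides of
any package, within distance [B * m], except with a probability that decreases
geometrically in [B]. *)
Lemma picked_close B n (j : 'I_n) : (0 < B)%N -> ((2 * (B * m)).+1 <= n)%N ->
  `|picked t q j - picked t q (center B)| <= 2 * (1 - x ^+ m) ^+ B.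
Proof.
move=> B0; set N := (2 * (B * m)).+1 => Nn.
have n0 : (0 < n)%N by exact: leq_trans Nn.
have Bm0 : (m <= B * m)%N by rewrite leq_pmull.
pose a := (j + (n - B * m))%N.
have jE : unroll a n0 (B * m) = j.
  apply: val_inj; rewrite /= /a -addnA subnK; last by rewrite /N in Nn; lia.
  by rewrite modnDr modn_small.
have [mV <-] := window_law a n0 Nn (center B).
have [Z [mZ PZ hZ]] := regular_ae hF lam0 (hq n) t0.
pose NB s := no_block (fun i => gap (q n) i 0 @^-1` `]t, +oo[)
  (location_blocks m a n0 B s).
have mNB s : measurable (NB s) by exact: measurable_no_quiet_block.
pose D := NB 0%N `|` NB (B * m).+1 `|` Z.
have mD : measurable D by do 2 apply: measurableU => //.
apply: (@le_trans _ _ (fine (P D))); last first.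
  rewrite -lee_fin fineK ?fin_num_measure//.
  apply: (@le_trans _ _ (P (NB 0%N `|` NB (B * m).+1) + P Z)%E).
    by apply: measureU2 => //; exact: measurableU.
  rewrite PZ adde0; apply: (@le_trans _ _ (P (NB 0%N) + P (NB (B * m).+1))%E).
    exact: measureU2.
  rewrite /NB !(probability_no_quiet_block m0 lam0 t0 hq); [|lia|lia].
  by rewrite -EFinD lee_fin mulr_natl mulr2n.
apply: probability_close => //; first exact: (measurable_picked t q).
move=> w nD.
have [fin inj marks first] : regular m (q n) t w.
  by apply: contrapT => nr; apply: nD; right; exact: hZ.
have [|b1 b1B q1] := @quiet_block_exists _ _ _ P m t q n a n0 B 0 w.
  by move=> h; apply: nD; left; left.
have [|b2 b2B q2] := @quiet_block_exists _ _ _ P m t q n a n0 B (B * m).+1 w.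
  by move=> h; apply: nD; left; right.
have h1 : (b1.+1 * m <= B * m)%N by rewrite leq_pmul2r.
have h2 : (b2.+1 * m <= B * m)%N by rewrite leq_pmul2r.
rewrite mulSn in h1; rewrite mulSn in h2.
pose zl := (b1 * m + m)%N; pose zr := ((B * m).+1 + b2 * m + m)%N.
have zrN : (zr <= N)%N by rewrite /zr /N; lia.
have := @available_local R n N a 0 m zl zr n0 (ltn0Sn _) (arrival (q n) w)
  (fun i l => mark (q n) i l w) (fun i l => arrival (q n) w (unroll a n0 i) l)
  (fun i l => mark (q n) (unroll a n0 i) l w) t m0.
move=> /(_ _ _ _ _ _ fin) h.
have uN u : (u < zr)%N -> val (unroll 0 (ltn0Sn _ : 0 < N)%N u) = u.
  by move=> uzr; rewrite /= modn_small// (leq_trans uzr).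
rewrite /=; have -> : (j \in remaining (q n) t w) = (center B \in window_remaining N a n0 w).
  rewrite -[in LHS]jE; apply: h => //.
  - by rewrite /zl; lia.
  - exact: leq_trans zrN Nn.
  - by rewrite (leq_trans Bm0)// (leq_trans _ Nn)// /N; lia.
  - by rewrite /N; lia.
  - pose g (y : 'I_n * nat) : 'I_N * nat := (unroll 0 (ltn0Sn _) (coord a y.1), y.2).
    apply: sub_finite_set (finite_image g fin) => -[i l] il.
    exists (unroll a n0 i, l) => //; rewrite /g /= unrollK ?(leq_trans _ Nn)//.
    by congr pair; apply: val_inj; rewrite /= modn_small//; exact: ltn_ord.
  - move=> [i l] [i' l'] /= e; have := inj (unroll a n0 i, l) (unroll a n0 i', l') e.
    move=> e'; congr pair; last exact: (congr1 snd e').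
    exact: (unroll_inj Nn (congr1 fst e')).
  - by move=> i l; have /andP[] := marks i l.
  - by move=> i l; have /andP[] := marks (unroll a n0 i) l.
  - by move=> u l uzr; rewrite uN.
  - by move=> u l uzr; rewrite uN.
  - move=> u l hu; apply: (@lt_le_trans _ _ (gap (q n) (unroll a n0 u) 0 w)).
      by case/orP: hu => hu; [apply: q1|apply: q2]; rewrite /zl /zr in hu; lia.
    exact: first.
  - by rewrite /zl /zr; lia.
by [].
Qed.

End comparison.

(** * The pick-up density *)

Section density.
Context {R : realType} {d : measure_display} {T : measurableType d}.
Variable P : probability T R.
Variables (m : nat) (F : probability nat R).
Hypothesis m0 : (0 < m)%N.
Hypothesis hF : F [set k | (1 <= k <= m)%N] = 1%E.
Variables (lam t : R) (q : forall n, requests P n).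
Hypothesis lam0 : 0 < lam.
Hypothesis t0 : 0 < t.
Hypothesis hq : forall n, marked_poisson F lam (q n).

Lemma mean_pickupsE n : mean_pickups (q n) t = \sum_j picked t q (j : 'I_n).
Proof.
pose U (j : 'I_n) := [set w | j \notin remaining (q n) t w].
have mU j : measurable (U j) by exact: (measurable_picked t q).
rewrite /mean_pickups expectation.unlock.
have -> : (\int[P]_w ((pickups (q n) t w)%:R)%:E =
    \int[P]_w (\sum_(j <- index_enum 'I_n) (\1_(U j) w)%:E))%E.
  apply: eq_integral => w _; rewrite sumEFin; congr EFin.
  rewrite /pickups -sum1_card natr_sum big_mkcond; apply: eq_bigr => j _.
  rewrite indicE inE; have [h|/negPn h] := boolP (j \notin remaining (q n) t w).
    by rewrite mem_set.
  by rewrite memNset// => /negP.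
rewrite ge0_integral_sum//; first last.
- by move=> j; apply/measurable_EFinP; exact: measurable_indic.
rewrite -[RHS]/(fine (\sum_j picked t q j)%:E) -sumEFin; congr fine.
apply: eq_bigr => j _; rewrite integral_indic// setIT /picked fineK//.
exact: (fin_num_measure P _ (mU j)).
Qed.

Lemma picked_itv n (j : 'I_n) : 0 <= picked t q j <= 1.
Proof.
have mU := measurable_picked t q j.
apply/andP; split; first by rewrite fine_ge0.
rewrite -lee_fin fineK ?fin_num_measure//.
exact: (probability_le1 P mU).
Qed.

Let a n := mean_pickups (q n) t / n%:R.

Lemma mean_close n (v e : R) : (0 < n)%N ->
  (forall j : 'I_n, `|picked t q j - v| <= e) -> `|a n - v| <= e.
Proof.
move=> n0 h; have nR : 0 < n%:R :> R by rewrite ltr0n.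
have -> : a n - v = (\sum_(j < n) (picked t q j - v)) / n%:R.
  rewrite sumrB -mean_pickupsE big_const_ord iter_addr addr0 mulrBl -/(a n).
  by rewrite -[v *+ n]mulr_natr mulfK ?gt_eqF.
rewrite normrM normfV (gtr0_norm nR) ler_pdivrMr//.
apply: le_trans (ler_norm_sum _ _ _) _.
apply: le_trans (ler_sum _ (fun j _ => h j)) _.
by rewrite big_const_ord iter_addr addr0 mulr_natr.
Qed.

(** The value [v] is the probability that the central package is picked up on a
circle that is just large enough for the required precision. *)
Lemma picked_eventually (e : R) : 0 < e ->
  exists v, exists2 N, (0 < N)%N &
    forall n, (N <= n)%N -> forall j : 'I_n, `|picked t q j - v| <= e.
Proof.
move=> e0; pose y := 1 - expR (- lam * t) ^+ m.
have y1 : `|y| < 1.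
  have x0 : 0 < expR (- lam * t) ^+ m by rewrite exprn_gt0// expR_gt0.
  have x1 : expR (- lam * t) ^+ m <= 1.
    rewrite exprn_ile1 ?expR_ge0// -[leRHS]expR0 ler_expR.
    by rewrite mulNr oppr_le0 mulr_ge0// ltW.
  by rewrite /y ltr_norml; apply/andP; split; lra.
have e20 : 0 < e / 2 by rewrite divr_gt0.
have := cvg_expr y1; move=> /cvgrPdist_lt /(_ _ e20) [k _ hk].
have := hk k.+1 (leqnSn k); rewrite /= sub0r normrN => yk.
have ye : 2 * y ^+ k.+1 <= e by have := ler_norm (y ^+ k.+1); lra.
eexists; exists (2 * (k.+1 * m)).+1 => // n Nn j.
exact: le_trans (picked_close m0 hF lam0 t0 hq j (ltn0Sn k) Nn) ye.
Qed.

Lemma cvg_mean_pickups : cvgn a.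
Proof.
apply/cauchy_cvgP/cauchyP => e e0.
have e20 : 0 < e / 2 by rewrite divr_gt0.
have [v [N N0 h]] := picked_eventually e20.
exists v; exists N => // n /= Nn; rewrite /ball /= distrC.
apply: le_lt_trans (mean_close (leq_trans N0 Nn) (h n Nn)) _.
by lra.
Qed.

Let alpha := limn a.

Lemma picked_near (e : R) : 0 < e -> exists n0, forall n, (n0 <= n)%N ->
  forall j : 'I_n, `|picked t q j - alpha| <= e.
Proof.
move=> e0; have e20 : 0 < e / 2 by rewrite divr_gt0.
have [v [N N0 h]] := picked_eventually e20.
have av : `|alpha - v| <= e / 2.
  have hn n : (N <= n)%N -> `|a n - v| <= e / 2.
    by move=> Nn; apply: mean_close (h n Nn); exact: leq_trans Nn.
  rewrite ler_distl; apply/andP; split.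
    apply: limr_ge; first exact: cvg_mean_pickups.
    by exists N => // n /= /hn; rewrite ler_distl => /andP[].
  apply: limr_le; first exact: cvg_mean_pickups.
  by exists N => // n /= /hn; rewrite ler_distl => /andP[].
exists N => n Nn j; have hj := h n Nn j.
apply: le_trans (ler_distD v _ _) _; rewrite (distrC v); lra.
Qed.

(** Every location with a request by time [t] has one of the next [m] packages
missing, so that a positive fraction of the packages is gone. *)
Lemma density_gt0 : 0 < alpha.
Proof.
pose y := 1 - expR (- lam * t).
have y0 : 0 < y by rewrite subr_gt0 -expR0 ltr_expR mulNr oppr_lt0 mulr_gt0.
have mR : 0 < m%:R :> R by rewrite ltr0n.
have e0 : 0 < y / (2 * m%:R) by rewrite divr_gt0// mulr_gt0.
have [n1 hn1] := picked_near e0.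
pose n := maxn m n1; have mn : (m <= n)%N by rewrite leq_maxl.
have n0 : (0 < n)%N by exact: leq_trans mn.
pose i0 : 'I_n := Ordinal n0.
pose U l := [set w | unroll 0 n0 l \notin remaining (q n) t w].
have mU l : measurable (U l) by exact: (measurable_picked t q).
pose A := gap (q n) i0 0 @^-1` `]-oo, t].
have mA : measurable A by exact: measurable_funPTI.
have [Z [mZ PZ hZ]] := regular_ae hF lam0 (hq n) t0.
have AU : A `<=` \big[setU/set0]_(l < m) U l `|` Z.
  move=> w Aw; have [rw|/hZ] := pselect (regular m (q n) t w); last by right.
  left; have [fin inj marks first] := rw.
  have pt : (i0, 0%N) \in chron (arrival (q n) w) t.
    rewrite mem_chron//=; move: Aw; rewrite /A /= in_itv /=.
    by rewrite /arrival big_ord_recl big_ord0 addr0.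
  have hm := marks i0 0%N.
  have rq : (i0, mark (q n) i0 0 w) \in
      [seq (z.1, mark (q n) z.1 z.2 w) | z <- chron (arrival (q n) w) t].
    exact: (map_f (fun z : 'I_n * nat => (z.1, mark (q n) z.1 z.2 w)) pt).
  have [|l lk hl] := foldl_serve_missing [set: 'I_n]%SET rq.
    by case/andP: hm => -> h /=; exact: leq_trans mn.
  have lm : (l < m)%N by case/andP: hm => _; exact: leq_trans.
  rewrite -bigcup_mkord; exists l => //=.
  by rewrite /U /= /remaining availableE; apply: hl; rewrite /= add0n.
have : fine (P A) <= \sum_(l < m) picked t q (unroll 0 n0 l).
  rewrite -lee_fin fineK ?fin_num_measure// -sumEFin.
  have mB : measurable (\big[setU/set0]_(l < m) U l) by exact: bigsetU_measurable.
  apply: (@le_trans _ _ (P (\big[setU/set0]_(l < m) U l `|` Z))).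
    by apply: le_measure; rewrite ?inE//; exact: measurableU.
  apply: (@le_trans _ _ (P (\big[setU/set0]_(l < m) U l) + P Z)%E).
    exact: measureU2.
  rewrite PZ adde0; apply: (@le_trans _ _ (\sum_(l < m) P (U l))%E).
    exact: Boole_inequality.
  by apply: lee_sum => l _; rewrite /picked fineK//; exact: (fin_num_measure P _ (mU l)).
rewrite (gap_le (hq n) t0) /= -/y => hy.
have : \sum_(l < m) picked t q (unroll 0 n0 l) <= m%:R * (alpha + y / (2 * m%:R)).
  rewrite -[m in leRHS]card_ord mulr_natl -sumr_const; apply: ler_sum => l _.
  have := hn1 n (leq_maxr _ _) (unroll 0 n0 l).
  by rewrite ler_distl => /andP[_]; rewrite card_ord.
have -> : m%:R * (alpha + y / (2 * m%:R)) = m%:R * alpha + y / 2.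
  by field; rewrite gt_eqF.
move=> hs; rewrite -(pmulr_rgt0 _ mR); lra.
Qed.

End density.

(** * Conditional expectation of a sum over independent events *)

Section integral_facts.
Local Open Scope ereal_scope.
Context {R : realType} {d : measure_display} {T : measurableType d}.

(** The integral of a nonnegative function is a supremum over simple functions,
so that it is monotone for all functions, measurable or not. *)
Lemma ge0_le_integral_any (mu : {measure set T -> \bar R}) (D : set T)
  (f g : T -> \bar R) : (forall x, D x -> 0 <= f x) ->
  (forall x, D x -> f x <= g x) ->
  \int[mu]_(x in D) f x <= \int[mu]_(x in D) g x.
Proof.
move=> f0 fg; rewrite integral_mkcond [leRHS]integral_mkcond.
have f0' x : 0 <= (f \_ D) x by exact: erestrict_ge0.
have fg' x : (f \_ D) x <= (g \_ D) x.
  by rewrite !patchE; case: ifPn => // /set_mem; exact: fg.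
rewrite !ge0_integralTE//; last by move=> x; exact: le_trans (fg' x).
apply: ge_ereal_sup => _ [h /= hf <-]; apply: ereal_sup_ubound.
by exists h => // x; apply: le_trans (fg' x).
Qed.

Lemma integral_mrestr (mu : {measure set T -> \bar R}) (A H : set T)
  (mH : measurable H) (f : T -> \bar R) : measurable A ->
  measurable_fun A f -> (forall x, A x -> 0 <= f x) ->
  \int[mrestr mu mH]_(x in A) f x = \int[mu]_(x in A `&` H) f x.
Proof.
move=> mA mf f0.
have mAH : measurable (A `&` H) by exact: measurableI.
have mAD : measurable (A `\` H) by exact: measurableD.
rewrite -{1}(setUIDK A H) ge0_integral_setU//; first last.
- by apply/disj_setPS => w [[_ Hw] [_ nH]].
- by rewrite setUIDK.
- by rewrite setUIDK.
rewrite [X in _ + X]null_set_integral ?adde0//; first last.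
- rewrite /= /mrestr (_ : _ `&` _ = set0) ?measure0//.
  by apply/seteqP; split => w // [[_ nH] /nH].
- by apply: measurable_funS mf => // w [].
apply: eq_measure_integral => B mB BAH; rewrite /= /mrestr setIidl//.
by move=> w /BAH [].
Qed.

(** On the sigma-algebra generated by [G], the measures [P (_ `&` H)] and
[P H * P _] coincide, hence so do the integrals of [f]. *)
Lemma integral_independent (P : probability T R) (G : set_system T) (A H : set T)
  (f : T -> \bar R) : <<s G >> `<=` measurable -> measurable H ->
  (forall B, <<s G >> B -> P (B `&` H) = P B * P H) ->
  (forall x, 0 <= f x) ->
  (forall B, measurable B -> <<s G >> (f @^-1` B)) -> <<s G >> A ->
  \int[P]_(x in A `&` H) f x = P H * \int[P]_(x in A) f x.
Proof.
move=> Gm mH indep f0 Gf GA.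
have mA : measurable A by exact: Gm.
have mf : measurable_fun setT f by move=> _ B mB; rewrite setTI; apply: Gm; exact: Gf.
pose T' : measurableType _ := g_sigma_algebraType G.
have mid : measurable_fun setT (id : T -> T').
  by move=> _ B mB; rewrite setTI; exact: Gm.
pose phi : {mfun T >-> T'} := HB.pack (id : T -> T')
  (isMeasurableFun.Build _ _ _ _ _ mid).
have mf' : measurable_fun setT (f : T' -> \bar R).
  by move=> _ B mB; rewrite setTI; exact: Gf.
have PH0 : (0 <= fine (P H))%R by rewrite fine_ge0.
pose r := NngNum PH0.
have push (mu : {measure set T -> \bar R}) :
    \int[pushforward mu phi]_(x in (A : set T')) f x = \int[mu]_(x in A) f x.
  rewrite ge0_integral_pushforward//; first exact: measurable_funS mf'.
rewrite -integral_mrestr//; last exact: measurable_funS mf.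
rewrite -push -[in RHS]push.
have -> : P H = r%:num%:E by rewrite /= fineK// fin_num_measure.
rewrite -ge0_integral_mscale//; last exact: measurable_funS mf'.
apply: eq_measure_integral => B mB BA.
rewrite /= /pushforward /mrestr /mscale /= /pushforward /= fineK ?fin_num_measure//.
by rewrite indep// muleC.
Qed.

End integral_facts.

Section conditional_bound.
Context {R : realType} {d : measure_display} {T : measurableType d}.
Variables (P : probability T R) (G : set_system T).
Hypothesis Gm : <<s G >> `<=` measurable.
Variables (U Y : T -> R) (I : finType) (r : I -> T -> R) (H : I -> set T).
Variables (box : set T) (c e D beta : R).
Hypothesis hY : is_cond_expectation P <<s G >> U Y.
Hypothesis mH : forall i, measurable (H i).
Hypothesis indep : forall i B, <<s G >> B -> P (B `&` H i) = (P B * P (H i))%E.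
Hypothesis Gr : forall i B, measurable B -> <<s G >> (r i @^-1` B).
Hypothesis Gbox : <<s G >> box.
Hypothesis r0 : forall i w, 0 <= r i w.
Hypothesis rD : forall i w, box w -> r i w <= D.
Hypothesis (c0 : 0 <= c) (e0 : 0 <= e).
Hypothesis hbeta : forall i, (P (H i) <= beta%:E)%E.
Hypothesis U0 : forall w, 0 <= U w.
Hypothesis hU : forall w, box w ->
  U w <= c * (\sum_i r i w * \1_(H i) w) + e.

Let h w := c * beta * (\sum_i r i w) + e.

Let T' : measurableType _ := g_sigma_algebraType G.

Let mr' i : measurable_fun setT (r i : T' -> R).
Proof. by move=> _ B mB; rewrite setTI; exact: Gr. Qed.

Let mh' : measurable_fun setT (h : T' -> R).
Proof.
apply: measurable_funD => //; apply: measurable_funM => //.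
by apply: measurable_sum => i; exact: mr'.
Qed.

Let from_sub (f : T -> R) : measurable_fun setT (f : T' -> R) -> measurable_fun setT f.
Proof. by move=> mf _ B mB; apply: Gm; exact: mf. Qed.

Let bad := box `&` [set w | h w < Y w].

Let Gbad : <<s G >> bad.
Proof.
have mY' : measurable_fun setT (Y : T' -> R).
  by case: hY => GY _ _ _ B mB; rewrite setTI; exact: GY.
have : measurable_fun setT ((fun w => h w < Y w) : T' -> bool).
  exact: measurable_fun_ltr.
move=> /(_ measurableT [set true] Logic.I); rewrite setTI => mb.
have -> : bad = box `&` ((fun w => h w < Y w) @^-1` [set true]).
  by apply/seteqP; split.
exact: (@measurableI _ T' _ _ Gbox mb).
Qed.

(** The event that the bound fails belongs to the sigma-algebra, so that [Y] and [U]
have the same integral over it; by independence, this is at most the integral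
of the bound, so that the event is negligible. *)
Lemma cond_expectation_le :
  {ae P, forall w, box w -> Y w <= c * beta * (\sum_i r i w) + e}.
Proof.
have mbad : measurable bad by exact: Gm.
have mr i : measurable_fun setT (r i) by apply: from_sub; exact: mr'.
have mh : measurable_fun setT h by apply: from_sub; exact: mh'.
have mY : measurable_fun setT Y.
  by case: hY => GY _ _ _ B mB; rewrite setTI; apply: Gm; exact: GY.
have Ybad : P.-integrable bad (EFin \o Y).
  by case: hY => _ iY _; apply: integrableS iY.
have beta0 (i : I) : 0 <= beta.
  by rewrite -lee_fin; apply: le_trans (hbeta i); exact: measure_ge0.
have h0 w : 0 <= h w.
  rewrite addr_ge0// -mulrA mulr_ge0// mulr_sumr sumr_ge0// => i _.
  by rewrite mulr_ge0// (beta0 i).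
have hbad : P.-integrable bad (EFin \o h).
  pose C := c * (\sum_(i : I) beta * D) + e.
  apply: (@le_integrable _ _ _ _ _ mbad _ (EFin \o cst C)) => //.
  - by apply/measurable_EFinP; exact: measurable_funS mh.
  - move=> w [bw _] /=; rewrite lee_fin ger0_norm//.
    apply: le_trans (ler_norm C); rewrite /C /h lerD2r -mulrA ler_wpM2l//.
    rewrite mulr_sumr ler_sum// => i _.
    by rewrite ler_wpM2l ?(beta0 i)// rD.
  - exact: finite_measure_integrable_cst.
have le1 : (\int[P]_(w in bad) (Y w)%:E <= \int[P]_(w in bad) (h w)%:E)%E.
  have [_ _ hint] := hY; rewrite hint//.
  apply: (@le_trans _ _ (\int[P]_(w in bad)
      (c%:E * (\sum_(i : I) (r i w * \1_(H i) w)%:E) + e%:E))%E).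
    apply: ge0_le_integral_any => w [bw _]; first by rewrite lee_fin.
    by rewrite sumEFin -EFinM -EFinD lee_fin hU.
  have mri i : measurable_fun bad (fun w => (r i w * \1_(H i) w)%:E).
    apply/measurable_EFinP; apply: measurable_funS measurableT _ _ => //.
    exact: measurable_funM.
  have ri0 i w : (0 <= (r i w * \1_(H i) w)%:E)%E.
    by rewrite lee_fin mulr_ge0.
  have iri i : (\int[P]_(w in bad) (r i w * \1_(H i) w)%:E <=
      \int[P]_(w in bad) (beta * r i w)%:E)%E.
    have -> : (\int[P]_(w in bad) (r i w * \1_(H i) w)%:E =
        \int[P]_(w in bad `&` H i) (r i w)%:E)%E.
      rewrite [RHS]integral_mkcondr; apply: eq_integral => w _.
      rewrite patchE indicE; case: ifP => hw; first by rewrite mulr1.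
      by rewrite mulr0.
    rewrite (@integral_independent _ _ _ P G)//; first last.
    - move=> B mB; rewrite (_ : _ @^-1` _ = r i @^-1` (EFin @^-1` B)).
        by apply: Gr; rewrite -[X in measurable X]setTI; by apply: EFin_measurable => //.
      by [].
    - by move=> w; rewrite lee_fin.
    - exact: indep.
    under [leRHS]eq_integral do rewrite EFinM.
    rewrite ge0_integralZl//; first last.
    - by rewrite lee_fin (beta0 i).
    - by move=> w _; rewrite lee_fin.
    - by apply/measurable_EFinP; exact: measurable_funS (mr i).
    apply: lee_wpmul2r => //; apply: integral_ge0 => w _; by rewrite lee_fin.
  have msum : measurable_fun bad (fun w => (\sum_(i : I) (r i w * \1_(H i) w)%:E)%E).
    by apply: emeasurable_sum => i; exact: mri.
  have mb i : measurable_fun bad (fun w => (beta * r i w)%:E).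
    apply/measurable_EFinP; apply: measurable_funM => //.
    exact: measurable_funS (mr i).
  have sum0 w : (0 <= (\sum_(i : I) (r i w * \1_(H i) w)%:E))%E.
    by apply: sume_ge0 => i _; exact: ri0.
  rewrite ge0_integralD//; first last.
  - exact: emeasurable_funM.
  - by move=> w _; rewrite mule_ge0// lee_fin.
  have -> : (\int[P]_(w in bad) (h w)%:E = \int[P]_(w in bad)
      (c%:E * (\sum_(i : I) (beta * r i w)%:E)) + \int[P]_(w in bad) e%:E)%E.
    rewrite -ge0_integralD//; first last.
    - by apply: emeasurable_funM => //; apply: emeasurable_sum => i; exact: mb.
    - move=> w _; rewrite mule_ge0 ?lee_fin// sume_ge0// => i _.
      by rewrite lee_fin mulr_ge0// (beta0 i).
    apply: eq_integral => w _; rewrite sumEFin -EFinM -EFinD; congr EFin.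
    by rewrite -mulr_sumr mulrA.
  rewrite leeD2r// !ge0_integralZl//; first last.
  - by move=> w _; rewrite sume_ge0// => i _; rewrite lee_fin mulr_ge0// (beta0 i).
  - by apply: emeasurable_sum => i; exact: mb.
  apply: lee_wpmul2l; first by rewrite lee_fin.
  rewrite !ge0_integral_sum//; first exact: lee_sum.
  by move=> i w _; rewrite lee_fin mulr_ge0// (beta0 i).
have int0 : (\int[P]_(w in bad) `|((EFin \o Y) \- (EFin \o h)) w| = 0)%E.
  have -> : (\int[P]_(w in bad) `|((EFin \o Y) \- (EFin \o h)) w| =
      \int[P]_(w in bad) ((EFin \o Y) \- (EFin \o h)) w)%E.
    apply: eq_integral => w /set_mem [_ hYw] /=.
    by rewrite ger0_norm// subr_ge0 ltW.
  apply/eqP; rewrite eq_le integralB//; apply/andP; split.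
    by rewrite sube_le0.
  rewrite -integralB//; apply: integral_ge0 => w [_ hYw] /=.
  by rewrite -EFinB lee_fin subr_ge0 ltW.
have mYh : measurable_fun bad ((EFin \o Y) \- (EFin \o h))%E.
  by apply: emeasurable_funB; apply/measurable_EFinP; apply: measurable_funS measurableT _ _.
have := (ae_eq_integral_abs P mbad mYh).1 int0.
apply: filterS => w hw bw; rewrite leNgt; apply/negP => hYw.
by have := hw (conj bw hYw); rewrite /= -EFinB => -[/eqP]; rewrite gt_eqF// subr_gt0.
Qed.

End conditional_bound.

(** * The limit superior of the cost difference *)

Section limit_superior.
Variable R : realType.

Lemma limn_esup_le (f : nat -> R) (L : R) :
  (forall e : R, 0 < e -> exists N, forall n, (N <= n)%N -> f n <= L + e) ->
  (limn_esup (fun n => (f n)%:E) <= L%:E)%E.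
Proof.
move=> h; apply/lee_addgt0Pr => e e0; have [N hN] := h e e0.
apply: (@le_trans _ _ (ereal_sup [set (f n)%:E | n in [set n | (N <= n)%N]])).
  by apply: ereal_inf_lbound; exists [set n | (N <= n)%N] => //; exists N.
by apply: ge_ereal_sup => _ [n /= /hN Nn <-]; rewrite -EFinD lee_fin.
Qed.

Section costs.
Variables (priv van : driver R) (EB z alpha rs : R) (V : nat).
Variables (C rbar tsp ecvrp cvrp : nat -> R).
Hypothesis hvan : driver_positive van.
Hypothesis C_itv : forall n, 0 <= C n <= n%:R.
Hypothesis C_cvg : (fun n => C n / n%:R) @ \oo --> alpha.
Hypothesis rbar_cvg : rbar @ \oo --> rs.
Hypothesis cvrp_ge : forall n, (0 < n)%N ->
  2 / V%:R * (n%:R * rbar n) <= cvrp n.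
Hypothesis hnear : forall k : nat, exists N, forall n, (N <= n)%N ->
  0 <= tsp n <= n%:R * k.+1%:R^-1 /\
  ecvrp n <= 2 / V%:R * (1 - alpha + k.+1%:R^-1) * (n%:R * rbar n)
    + n%:R * k.+1%:R^-1.

Let A := mile_cost priv + (hourly_cost priv + z) / speed priv.
Let B := mile_cost van + hourly_cost van / speed van.
Let S := (hourly_cost priv + z) * stop_time priv - hourly_cost van * stop_time van.

Let B0 : 0 <= B.
Proof.
by case: hvan => h1 h2 h3 h4; rewrite addr_ge0 ?divr_ge0// ltW.
Qed.

Let upper (eta : R) n := C n / n%:R * (A * (rbar n / EB) + S) + `|A| * eta
  + B * (2 / V%:R * (eta - alpha) * rbar n + eta).

(** The tours contribute at most [`|A| * eta], whatever the sign of [A] is: the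
incentive [z] may be negative. *)
Let cost_le n (eta : R) : (0 < n)%N -> 0 <= eta ->
  0 <= tsp n <= n%:R * eta ->
  ecvrp n <= 2 / V%:R * (1 - alpha + eta) * (n%:R * rbar n) + n%:R * eta ->
  (cost_P priv van EB n z (C n) (rbar n) (tsp n) (ecvrp n)
    - cost_V van n (cvrp n)) / n%:R <= upper eta n.
Proof.
move=> n0 eta0 /andP[tsp0 tspn] he; have hc := cvrp_ge n0.
have nR : 0 < n%:R :> R by rewrite ltr0n.
have /andP[C0 Cn] := C_itv n.
have c0 : 0 <= C n / n%:R by rewrite divr_ge0.
have c1 : C n / n%:R <= 1 by rewrite ler_pdivrMr// mul1r.
have hAt : C n / n%:R * A * tsp n <= n%:R * (`|A| * eta).
  apply: (@le_trans _ _ (1 * `|A| * tsp n)).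
    rewrite ler_wpM2r//; apply: (@le_trans _ _ (C n / n%:R * `|A|)).
      by rewrite ler_wpM2l// ler_norm.
    by rewrite ler_wpM2r.
  by rewrite mul1r mulrCA ler_wpM2l.
have hB : B * (ecvrp n - cvrp n) <=
    n%:R * (B * (2 / V%:R * (eta - alpha) * rbar n + eta)).
  rewrite mulrCA ler_wpM2l//; lra.
rewrite ler_pdivrMr// mulrC.
have -> : cost_P priv van EB n z (C n) (rbar n) (tsp n) (ecvrp n)
    - cost_V van n (cvrp n) =
    C n / n%:R * A * tsp n + B * (ecvrp n - cvrp n)
    + n%:R * (C n / n%:R * (A * (rbar n / EB) + S)).
  rewrite /cost_P /cost_V -/A -/B /S.
  have e : C n = n%:R * (C n / n%:R) by rewrite mulrC mulfVK ?gt_eqF.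
  set c := C n / n%:R in e *; rewrite e; ring.
by rewrite /upper; lra.
Qed.

Let upper_lim (eta : R) : upper eta @ \oo -->
  alpha * (A * (rs / EB) + S) + `|A| * eta
  + B * (2 / V%:R * (eta - alpha) * rs + eta).
Proof.
apply: cvgD; last first.
  apply: cvgM; first exact: cvg_cst.
  apply: cvgD; last exact: cvg_cst.
  by apply: cvgM => //; exact: cvg_cst.
apply: cvgD; last exact: cvg_cst.
apply: cvgM => //; apply: cvgD; last exact: cvg_cst.
apply: cvgM; first exact: cvg_cst.
by apply: cvgM => //; exact: cvg_cst.
Qed.

Lemma limn_esup_cost :
  (limn_esup (fun n => ((cost_P priv van EB n z (C n) (rbar n) (tsp n) (ecvrp n)
    - cost_V van n (cvrp n)) / n%:R)%:E) <=
  (upper_bound priv van EB V alpha z rs)%:E)%E.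
Proof.
apply: limn_esup_le => e e0.
pose M : R := `|A| + B * (2 / V%:R * `|rs|) + B.
have VV : 0 <= 2 / V%:R :> R by exact: divr_ge0.
have M0 : 0 <= M.
  by apply: addr_ge0 => //; apply: addr_ge0 => //; do 2 apply: mulr_ge0 => //.
pose k := Num.truncn (2 * M / e).
pose eta : R := k.+1%:R^-1.
have eta0 : 0 < eta by rewrite invr_gt0.
have Meta : M * eta <= e / 2.
  have q0 : 0 <= 2 * M / e by rewrite divr_ge0 ?(ltW e0)// mulr_ge0.
  have /andP[_ h] := truncn_itv q0; rewrite -/k in h.
  rewrite /eta ler_pdivrMr ?ltr0n//.
  by move: h; rewrite ltr_pdivrMr// => h; lra.
have [N hN] := hnear k; rewrite -/eta in hN.
have e20 : 0 < e / 2 by rewrite divr_gt0.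
have := @upper_lim eta; move=> /cvgrPdist_lt /(_ _ e20) [N' _ hN'].
exists (maxn 1 (maxn N N')) => n; rewrite !geq_max => /and3P[n0 Nn N'n].
have [h1 h2] := hN n Nn.
apply: le_trans (cost_le n0 (ltW eta0) h1 h2) _.
have := hN' n N'n; rewrite /= ltr_distlC => /andP[_ h].
apply: le_trans (ltW h) _.
have hrs : B * (2 / V%:R * eta * rs) <= B * (2 / V%:R * `|rs|) * eta.
  have -> : B * (2 / V%:R * `|rs|) * eta = B * (2 / V%:R * eta * `|rs|) by ring.
  apply: ler_wpM2l => //; apply: ler_wpM2l; last exact: ler_norm.
  by apply: mulr_ge0; [exact: divr_ge0|exact: ltW].
have -> : upper_bound priv van EB V alpha z rs =
    alpha * (A * (rs / EB) + S) - B * (2 / V%:R * alpha * rs).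
  by rewrite /upper_bound /margin /A /B /S invfM; ring.
rewrite /M in Meta; lra.
Qed.

End costs.

End limit_superior.

(** * Destinations and the comparison of costs *)

Section destinations.
Context {R : realType} {d : measure_display} {T : measurableType d}.
Variable P : probability T R.

Lemma compact_in_box (K : set (R * R)) : compact K ->
  exists2 D : R, 0 <= D & forall a, K a -> in_box D a.
Proof.
move=> /compact_bounded[M [_ /(_ (`|M| + 1)) hM]].
exists (`|M| + 1); first by rewrite addr_ge0.
have M1 : M < `|M| + 1 by rewrite (le_lt_trans (ler_norm M))// ltrDl.
move=> [a1 a2] Ka; have := hM M1 _ Ka.
by rewrite /= prod_normE /= ge_max => /andP[].
Qed.

Lemma measurable_in_box (D : R) : measurable [set a : R * R | in_box D a].
Proof.
have -> : [set a : R * R | in_box D a] = `[- D, D]%classic `*` `[- D, D]%classic.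
  by apply/seteqP; split => -[a b] /=; rewrite /in_box /= !in_itv /= -!ler_norml.
exact: measurableX.
Qed.

Variables (n : nat) (x : 'I_n -> {RV P >-> (R * R)%type}).

Lemma g_sigma_preimage_ev i B : measurable B -> g_sigma_preimage x (x i @^-1` B).
Proof.
move=> mB; apply: sub_sigma_algebra; rewrite -bigcup_seq; exists i => /=.
  by rewrite mem_index_enum.
by exists B => //; rewrite setTI.
Qed.

Lemma g_sigma_preimage_measurable : g_sigma_preimage x `<=` measurable.
Proof.
apply: (smallest_sub (@sigma_algebra_measurable _ T)) => A.
rewrite -bigcup_seq => -[i _ [B mB <-]]; rewrite setTI.
exact: (measurable_funPTI (x i) mB).
Qed.

Lemma g_sigma_preimage_box (D : R) :
  g_sigma_preimage x [set w | forall i, in_box D (x i w)].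
Proof.
rewrite (_ : [set w | _] = \bigcap_(i in [set: 'I_n]) (x i @^-1` [set a | in_box D a])).
  apply: (@fin_bigcap_measurable _ (g_sigma_algebraType
    (\big[setU/set0]_(i < n) preimage_set_system setT (x i) measurable))) => //.
  by move=> i _; apply: g_sigma_preimage_ev; exact: measurable_in_box.
by apply/seteqP; split => w hw i; [move=> _; exact: hw|exact: (hw i I)].
Qed.

End destinations.

Section expected_routing.
Context {R : realType} {d : measure_display} {T : measurableType d}.
Variable P : probability T R.

(** Every package being left behind with nearly the same probability,
independently of the destinations, the radial part of the routing cost is
multiplied by this probability. *)
Lemma expected_cvrp_le (p : \bar R) (V n : nat) (x : 'I_n -> {RV P >-> (R * R)%type})
  (Q : requests P n) (t D e beta : R) (Y : T -> R) :
  (1 <= p)%E -> (0 < V)%N -> 0 <= e ->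
  is_cond_expectation P (g_sigma_preimage x) (fun w =>
    cvrp_length (Lp_dist p) (fun i => x i w) V (remaining Q t w)) Y ->
  independent_systems P (g_sigma_preimage x) (request_sigma Q) ->
  request_sigma Q `<=` measurable ->
  (forall i, request_sigma Q [set w | i \in remaining Q t w]) ->
  (forall i, (P [set w | i \in remaining Q t w] <= beta%:E)%E) ->
  (forall y : 'I_n -> R * R, (forall i, in_box D (y i)) -> forall A : {set 'I_n},
    cvrp_length (Lp_dist p) y V A <=
      2 / V%:R * (\sum_(i in A) Lp_dist p (y i) 0) + e) ->
  {ae P, forall w, (forall i, in_box D (x i w)) ->
    Y w <= 2 / V%:R * beta * (\sum_i Lp_dist p (x i w) 0) + e}.
Proof.
move=> p1 V0 e0 hY indep mQ remQ hbeta hcvrp.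
have hd := Lp_dist_planar p1.
have d0 a b : 0 <= Lp_dist p a b by case: hd.
apply: (@cond_expectation_le _ _ _ P _ _ _ Y _ (fun i w => Lp_dist p (x i w) 0)
  (fun i => [set w | i \in remaining Q t w])
  [set w | forall i, in_box D (x i w)] (2 / V%:R) e (2 * D) beta hY).
- exact: g_sigma_preimage_measurable.
- by move=> i; apply: mQ; exact: remQ.
- by move=> i B GB; exact: indep.
- move=> i B mB; rewrite (_ : _ @^-1` _ =
    x i @^-1` ((fun a => Lp_dist p a 0) @^-1` B)) //.
  apply: g_sigma_preimage_ev; rewrite -[X in measurable X]setTI.
  exact: (measurable_Lp_dist0 p1 measurableT).
- exact: g_sigma_preimage_box.
- by move=> i w; exact: d0.
- by move=> i w hw; exact: (in_box_dist0 hd).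
- by rewrite divr_ge0.
- exact: e0.
- exact: hbeta.
- by move=> w; exact: cvrp_length_ge0.
move=> w hw; apply: le_trans (hcvrp _ hw _) _; rewrite lerD2r ler_wpM2l ?divr_ge0//.
rewrite big_mkcond ler_sum// => i _; rewrite indicE.
have [h|h] := boolP (i \in remaining Q t w); first by rewrite mem_set// mulr1.
by rewrite mulr_ge0.
Qed.

End expected_routing.

Theorem lemma3p5 (R : realType) (d : measure_display) (Omega : measurableType d)
  (P : probability Omega R)
  (m : nat) (hm : (0 < m)%N)
  (F : probability nat R) (hF : F [set k | (1 <= k <= m)%N] = 1%E)
  (T : R) (hT : 0 < T)
  (V : nat) (hV : (0 < V)%N)
  (p : \bar R) (hp : (1 <= p)%E)
  (priv van : driver R)
  (hpriv : driver_positive priv) (hvan : driver_positive van)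
  (lambda : R -> R)
  (hlambda_gt0 : forall z, 0 < lambda z)
  (hlambda_mono : {homo lambda : z z' / z <= z'})
  (hlambda_diff : {ae lebesgue_measure, forall z : R, derivable lambda z 1})
  (x : forall n, 'I_n -> {RV P >-> (R * R)%type})
  (q : forall n, R -> requests P n)
  (hq : forall n lam, 0 < lam -> marked_poisson F lam (q n lam))
  (hxq : forall n lam, 0 < lam ->
     independent_systems P (g_sigma_preimage (@x n)) (request_sigma (q n lam)))
  (htour : {ae P, forall w, forall n,
     closed_length (Lp_dist p) [seq x n i w | i <- enum 'I_n]
       = tsp_length (Lp_dist p) (fun i => x n i w)})
  (Ecvrp : nat -> R -> Omega -> R)
  (hEcvrp : forall n lam, 0 < lam ->
     is_cond_expectation P (g_sigma_preimage (@x n))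
       (fun w => cvrp_length (Lp_dist p) (fun i => x n i w) V
                   (remaining (q n lam) T w))
       (Ecvrp n lam))
  (K : set (R * R)) (hK : compact K)
  (hxK : {ae P, forall w, forall n (i : 'I_n), K (x n i w)})
  (rstar : Omega -> R) :
  let EB := fine 'E_F[fun k => k%:R] in
  let rbar n w := (\sum_(i < n) Lp_dist p (x n i w) 0) / n%:R in
  let CostP z n w :=
    cost_P priv van EB n z (mean_pickups (q n (lambda z)) T) (rbar n w)
      (tsp_length (Lp_dist p) (fun i => x n i w)) (Ecvrp n (lambda z) w) in
  let CostV n w :=
    cost_V van n
      (cvrp_length (Lp_dist p) (fun i => x n i w) V [set: 'I_n]%SET) in
  let limsup_diff z w :=
    limn_esup (fun n => ((CostP z n w - CostV n w) / n%:R)%:E) in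
  let bound z w :=
    upper_bound priv van EB V (pickup_density q T (lambda z)) z (rstar w) in
  {ae P, forall w, (fun n => rbar n w) @ \oo --> rstar w} ->
  (forall z, {ae P, forall w, (limsup_diff z w <= (bound z w)%:E)%E}) /\
  {ae P, forall w, 0 < margin priv van EB V (rstar w) ->
     exists z, (limsup_diff z w <= (bound z w)%:E)%E /\ bound z w < 0}.
Proof.
move=> EB rbar CostP CostV limsup_diff bound hrbar.
have hd := Lp_dist_planar hp.
have [D D0 KD] := compact_in_box hK.
have hbox : {ae P, forall w, forall n (i : 'I_n), in_box D (x n i w)}.
  by apply: filterS hxK => w h n i; exact: KD.
have main z : {ae P, forall w, (limsup_diff z w <= (bound z w)%:E)%E}.
  pose lam := lambda z; have lam0 : 0 < lam by exact: hlambda_gt0.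
  pose Q n := q n lam; have hQ n : marked_poisson F lam (Q n) by exact: hq.
  pose alpha := pickup_density q T lam.
  have mQ n : request_sigma (Q n) `<=` measurable.
    exact: (@request_sigma_measurable _ _ _ P Q n).
  have remQ n i : request_sigma (Q n) [set w | i \in remaining (Q n) T w].
    exact: (@request_sigma_remaining _ _ _ P T Q n i).
  have hE (k : nat) : {ae P, forall w, exists N, forall n, (N <= n)%N ->
      (forall i, in_box D (x n i w)) ->
      Ecvrp n lam w <= 2 / V%:R * (1 - alpha + k.+1%:R^-1) * (n%:R * rbar n w)
        + n%:R * k.+1%:R^-1}.
    pose eta : R := k.+1%:R^-1; have eta0 : 0 < eta by rewrite invr_gt0.
    have [n1 hn1] := cvrp_length_le_box hd hV D0 eta0.
    have [n2 hn2] := picked_near hm hF lam0 hT hQ eta0.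
    pose N := maxn 1 (maxn n1 n2).
    suff : {ae P, forall w, forall n, (N <= n)%N ->
        (forall i, in_box D (x n i w)) ->
        Ecvrp n lam w <= 2 / V%:R * (1 - alpha + eta) * (n%:R * rbar n w)
          + n%:R * eta}.
      by apply: filterS => w h; exists N.
    apply: ae_countable => n; have [nN|] := ltnP n N.
      by apply: aeW.
    rewrite !geq_max => /and3P[n0 n1n n2n].
    have hrem i : (P [set w | i \in remaining (Q n) T w] <= (1 - alpha + eta)%:E)%E.
      have mpick := measurable_picked T Q i.
      have -> : [set w | i \in remaining (Q n) T w] =
          ~` [set w | i \notin remaining (Q n) T w].
        by apply/seteqP; split => w /= => [h /negP //|/negP/negPn].
      rewrite probability_setC// -(fineK (fin_num_measure P _ mpick)) -EFinB lee_fin.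
      have /andP[h _] : alpha - eta <= picked T Q i <= alpha + eta.
        by rewrite -ler_distl; exact: hn2.
      by rewrite /picked in h; lra.
    have e0 : 0 <= n%:R * eta by rewrite mulr_ge0// ltW.
    have := expected_cvrp_le hp hV e0 (hEcvrp n lam lam0) (hxq n lam lam0) (@mQ n)
      (remQ n) hrem (hn1 n n1n).
    apply: filterS => w h _ /h.
    suff -> : n%:R * rbar n w = \sum_(i < n) Lp_dist p (x n i w) 0 by [].
    by rewrite /rbar mulrC mulfVK// pnatr_eq0 -lt0n.
  have hE' : {ae P, forall w, forall k : nat, exists N, forall n, (N <= n)%N ->
      (forall i, in_box D (x n i w)) ->
      Ecvrp n lam w <= 2 / V%:R * (1 - alpha + k.+1%:R^-1) * (n%:R * rbar n w)
        + n%:R * k.+1%:R^-1}.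
    exact: ae_countable.
  apply: filterS3 hrbar hbox hE' => w hr hb hc.
  apply: (@limn_esup_cost R priv van EB z alpha (rstar w) V
    (fun n => mean_pickups (Q n) T) (fun n => rbar n w)
    (fun n => tsp_length (Lp_dist p) (fun i => x n i w))
    (fun n => Ecvrp n lam w)
    (fun n => cvrp_length (Lp_dist p) (fun i => x n i w) V [set: 'I_n]%SET)
    hvan) => //.
  - move=> n; rewrite mean_pickupsE; apply/andP; split.
      by apply: sumr_ge0 => j _; have /andP[] := picked_itv T Q j.
    rewrite -[n in leRHS]card_ord -sumr_const; apply: ler_sum => j _.
    by have /andP[] := picked_itv T Q j.
  - exact: (cvg_mean_pickups hm hF lam0 hT hQ).
  - move=> n n0; have := cvrp_length_ge hd (fun i => x n i w) hV.
    suff -> : n%:R * rbar n w = \sum_(i < n) Lp_dist p (x n i w) 0 by [].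
    by rewrite /rbar mulrC mulfVK// pnatr_eq0 -lt0n.
  - move=> k; have [N hN] := hc k.
    have eta0 : 0 < k.+1%:R^-1 :> R by rewrite invr_gt0.
    have [N' hN'] := tsp_length_le_box hd D0 eta0.
    exists (maxn N N') => n; rewrite geq_max => /andP[Nn N'n]; split.
      by rewrite tsp_length_ge0//= hN'.
    exact: hN.
split=> //.
apply: filterS (main 0) => w h0 hmargin; exists 0; split=> //.
have alpha0 : 0 < pickup_density q T (lambda 0).
  by apply: (density_gt0 hm hF (hlambda_gt0 0) hT) => n; exact: hq.
by rewrite /bound /upper_bound mul0r subr0 mulNr oppr_lt0 mulr_gt0.
Qed.
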